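(* Let $E$ and $F$ be Hilbert $C^*$-modules over $C^*$-algebras $A$ and $B$, respectively, and let $T$ be a surjective linear 2-isometry from $E$ onto $F$. Then there exists a $*$-isomorphism $\varphi$ from $\overline{\langle E,E\rangle}$ onto $\overline{\langle F,F\rangle}$ such that $$\langle Tx,Ty\rangle=\varphi(\langle x,y\rangle)\quad\text{for all }x,y\in E,$$ and $$T(xa)=T(x)\varphi(a)\quad\text{for all }x\in E\text{ and all }a\in\overline{\langle E,E\rangle}.$$
   Context: A (right) Hilbert $C^*$-module over a $C^*$-algebra $A$ is a right $A$-module $E$ (a complex vector space with compatible action) equipped with an $A$-valued (positive definite) inner product $\langle\cdot,\cdot\rangle$ which is conjugate $A$-linear in the first variable (so $\langle xa,y\rangle=a^*\langle x,y\rangle$) and $A$-linear in the second variable ($\langle x,ya\rangle=\langle x,y\rangle a$), such that $E$ is a Banach space with respect to the norm $\|x\|=\|\langle x,x\rangle\|^{1/2}$. $\langle E,E\rangle$ denotes the linear span in $A$ of the elements $\langle x,y\rangle$, $x,y\in E$, and $\overline{\langle E,E\rangle}$ its norm closure, a closed two-sided ideal of $A$ (hence a $C^*$-algebra); similarly for $F$ and $B$. For a positive integer $n$, $M_n(E)$ is the space of $n\times n$ matrices with entries in $E$, normed by its natural structure of Hilbert $C^*$-module over $M_n(A)$, with inner product $\langle (x_{ij}),(y_{ij})\rangle=\big(\sum_k\langle x_{ki},y_{kj}\rangle\big)_{ij}$ (equivalently, the operator norm obtained when $E$ is identified with a norm-closed ternary ring of operators). For a linear map $T:E\to F$, $T^{(n)}:M_n(E)\to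 M_n(F)$ is defined by $T^{(n)}((x_{ij}))=(T(x_{ij}))$. $T$ is called an $n$-isometry if $T^{(n)}$ is isometric; thus a 2-isometry is a map $T$ for which $T^{(2)}$ is isometric. *)

(* Defs.v *)
From HB Require Import structures.
From mathcomp Require Import all_boot all_order all_algebra.
From mathcomp Require Import complex.
From mathcomp Require Import boolp classical_sets functions reals.
From mathcomp Require Import topology normedtype.

Set Implicit Arguments.
Unset Strict Implicit.
Unset Printing Implicit Defensive.

Import Order.TTheory GRing.Theory Num.Theory.
Import numFieldNormedType.Exports.

Local Open Scope classical_set_scope.
Local Open Scope ring_scope.
Local Open Scope complex_scope.

(* C*-algebras, not assumed unital: MathComp rings have a unit, so the product
   is a separate operation on a complex Banach space. *)
HB.mixin Record isCStarAlgebra (R : realType) A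
    of CompleteNormedModule R[i] A := {
  cmul : A -> A -> A;
  cstar : A -> A;
  cmulA : forall a b c, cmul a (cmul b c) = cmul (cmul a b) c;
  cmulDl : forall a b c, cmul (a + b) c = cmul a c + cmul b c;
  cmulDr : forall a b c, cmul a (b + c) = cmul a b + cmul a c;
  cmulZl : forall (l : R[i]) a b, cmul (l *: a) b = l *: cmul a b;
  cmulZr : forall (l : R[i]) a b, cmul a (l *: b) = l *: cmul a b;
  cstarK : forall a, cstar (cstar a) = a;
  cstarD : forall a b, cstar (a + b) = cstar a + cstar b;
  cstarZ : forall (l : R[i]) a, cstar (l *: a) = l^* *: cstar a;
  cstarM : forall a b, cstar (cmul a b) = cmul (cstar b) (cstar a);
  cnormM : forall a b, `|cmul a b| <= `|a| * `|b|;
  cnorm_star : forall a, `|cmul (cstar a) a| = `|a| ^+ 2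
}.

#[short(type="cstarAlgType")]
HB.structure Definition CStarAlgebra (R : realType) :=
  {A of CompleteNormedModule R[i] A & isCStarAlgebra R A}.

Definition cpos (R : realType) (A : cstarAlgType R) (a : A) : Prop :=
  exists b : A, a = cmul (cstar b) b.

(* Right Hilbert C*-modules. The Banach norm of the underlying space is required
   to be the one induced by the inner product; definiteness and the behaviour of
   the inner product in its first variable are derived below. *)
HB.mixin Record isHilbertModule (R : realType) (A : cstarAlgType R) E
    of CompleteNormedModule R[i] E := {
  ract : E -> A -> E;
  ractDl : forall x y a, ract (x + y) a = ract x a + ract y a;
  ractDr : forall x a b, ract x (a + b) = ract x a + ract x b;
  ractZl : forall (l : R[i]) x a, ract (l *: x) a = l *: ract x a;
  ractZr : forall (l : R[i]) x a, ract x (l *: a) = l *: ract x a;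
  ractM : forall x a b, ract x (cmul a b) = ract (ract x a) b;
  inner : E -> E -> A;
  innerDr : forall x y z, inner x (y + z) = inner x y + inner x z;
  innerZr : forall (l : R[i]) x y, inner x (l *: y) = l *: inner x y;
  innerMr : forall x y a, inner x (ract y a) = cmul (inner x y) a;
  inner_star : forall x y, cstar (inner x y) = inner y x;
  inner_pos : forall x, cpos (inner x x);
  norm_inner : forall x, `|x| ^+ 2 = `|inner x x|
}.

#[short(type="hilbertModType")]
HB.structure Definition HilbertModule (R : realType) (A : cstarAlgType R) :=
  {E of CompleteNormedModule R[i] E & isHilbertModule R A E}.

Section inner_theory.
Context (R : realType) (A : cstarAlgType R) (E : hilbertModType A).
Implicit Types (x y z : E) (a : A).

Lemma innerDl x y z : inner (x + y) z = inner x z + inner y z.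
Proof. by rewrite -inner_star innerDr cstarD !inner_star. Qed.

Lemma innerZl (l : R[i]) x y : inner (l *: x) y = l^* *: inner x y.
Proof. by rewrite -inner_star innerZr cstarZ inner_star. Qed.

Lemma innerMl x y a : inner (ract x a) y = cmul (cstar a) (inner x y).
Proof. by rewrite -inner_star innerMr cstarM inner_star. Qed.

Lemma inner_eq0 x : inner x x = 0 <-> x = 0.
Proof.
split=> [x0|->]; last by rewrite -[X in inner _ X](scale0r 0) innerZr scale0r.
by apply/eqP; rewrite -normr_eq0 -sqrf_eq0 norm_inner x0 normr0.
Qed.

End inner_theory.

(* The norm of a normed space over R[i] takes its values in R[i]. *)
Definition rnorm (R : realType) (V : normedModType R[i]) (x : V) : R :=
  complex.Re `|x|.

Section matrix_norms.
Context (R : realType).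

Definition cmulmx (A : cstarAlgType R) m n p
    (a : 'M[A]_(m, n)) (b : 'M[A]_(n, p)) : 'M[A]_(m, p) :=
  \matrix_(i, j) \sum_k cmul (a i k) (b k j).

Definition colnorm (A : cstarAlgType R) n (v : 'cV[A]_n) : R :=
  Num.sqrt (rnorm (\sum_i cmul (cstar (v i ord0)) (v i ord0))).

(* The C*-norm of M_n(A): the operator norm of left multiplication on the
   Hilbert A-module A^n, whose norm is colnorm. *)
Definition mxcnorm (A : cstarAlgType R) n (a : 'M[A]_n) : R :=
  sup [set colnorm (cmulmx a v) | v in [set v : 'cV[A]_n | colnorm v <= 1]].

Definition innermx (A : cstarAlgType R) (E : hilbertModType A) n
    (x y : 'M[E]_n) : 'M[A]_n :=
  \matrix_(i, j) \sum_k inner (x k i) (y k j).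

Definition mxhnorm (A : cstarAlgType R) (E : hilbertModType A) n
    (x : 'M[E]_n) : R :=
  Num.sqrt (mxcnorm (innermx x x)).

Definition n_isometry (A B : cstarAlgType R) (E : hilbertModType A)
    (F : hilbertModType B) (n : nat) (T : E -> F) : Prop :=
  forall x : 'M[E]_n, mxhnorm (map_mx T x) = mxhnorm x.

Definition inner_span (A : cstarAlgType R) (E : hilbertModType A) : set A :=
  [set a | exists (n : nat) (l : 'I_n -> R[i]) (x y : 'I_n -> E),
      a = \sum_(i < n) l i *: inner (x i) (y i)].

Definition inner_ideal (A : cstarAlgType R) (E : hilbertModType A) : set A :=
  closure (inner_span E).

(* phi restricts to a *-isomorphism of I onto J; its values outside I are
   irrelevant. *)
Definition star_isomorphism_on (A B : cstarAlgType R) (I : set A) (J : set B)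
    (phi : A -> B) : Prop :=
  [/\ set_bij I J phi,
      forall a b, I a -> I b -> phi (a + b) = phi a + phi b,
      forall (l : R[i]) a, I a -> phi (l *: a) = l *: phi a,
      forall a b, I a -> I b -> phi (cmul a b) = cmul (phi a) (phi b)
    & forall a, I a -> phi (cstar a) = cstar (phi a)].

End matrix_norms.

(* Main.v *)
Require Import Defs.
From HB Require Import structures.
From mathcomp Require Import all_boot all_order all_algebra.
From mathcomp Require Import ring lra.
From mathcomp Require Import complex.
From mathcomp Require Import boolp classical_sets functions reals.
From mathcomp Require Import topology normedtype.

Set Implicit Arguments.
Unset Strict Implicit.
Unset Printing Implicit Defensive.

Import Order.TTheory GRing.Theory Num.Theory.
Import numFieldNormedType.Exports.

Local Open Scope classical_set_scope.
Local Open Scope ring_scope.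
Local Open Scope complex_scope.

(** On columns [z = (z1, z2)] over a Hilbert module put
    [|z|^2 = |<z1,z1> + <z2,z2>|]; a 2-isometry preserves this norm.  For every
    [a] the quadratic vector field [(0, a) - z <a, z2>] is tangent to the unit
    ball, up to second order.  Transporting the field of [a] along [T] and
    subtracting the field of [T a] leaves a homogeneous quadratic field that is
    still tangent to the ball, hence zero by Cartan's uniqueness argument.  This
    says [T (x <a, y>) = T x <T a, T y>].  The right action of the span of the
    inner products then determines [phi], which is isometric on the span because
    [|b|^(2n) = |(b^* b)^n|], and so extends to the closure.

    The order structure of a C*-algebra is obtained without spectral theory:
    [X] is positive when [|t - X| <= t] for some [t >= 0], in the unitization. *)

(** * Identities in abelian groups *)

(** Columns of length two are needed because the field on [E] itself only sees the symmetric product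
    [x <a, x>]. In a column the entries [z1] and [z2] are independent, so the first row [z1 <a, z2>]
    recovers the full ternary product. The fields are only conjugate linear in [a], but they are
    quadratic over the complex numbers in [z], as Cartan's argument requires. No flow is integrated:
    a single step of length [s], with error of order [s^2], is iterated, and averages over roots of
    unity replace contour integrals. Sending a sum of terms [<x, y>] to the sum of the [<T x, T y>]
    is neither evidently well defined nor evidently continuous; one norm inequality on pairs of such
    sums settles both. Once constructed, the order serves one purpose: [|p| <= |p + q|] for positive
    [p], [q]. Each estimate is therefore an exact identity with a positive remainder. *)

Inductive zexp := ZV of nat | ZA of zexp & zexp | ZN of zexp | Z0.

Fixpoint zeval (V : zmodType) (e : seq V) (t : zexp) : V :=
  match t with
  | ZV i => e`_i
  | ZA a b => zeval e a + zeval e b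
  | ZN a => - zeval e a
  | Z0 => 0
  end.

Fixpoint zcoef (t : zexp) (i : nat) : nat * nat :=
  match t with
  | ZV j => (nat_of_bool (i == j), 0%N)
  | ZA a b => ((zcoef a i).1 + (zcoef b i).1, (zcoef a i).2 + (zcoef b i).2)%N
  | ZN a => ((zcoef a i).2, (zcoef a i).1)
  | Z0 => (0%N, 0%N)
  end.

Lemma zevalE (V : zmodType) (e : seq V) (t : zexp) :
  zeval e t = \sum_(i < size e) (e`_i *+ (zcoef t i).1 - e`_i *+ (zcoef t i).2).
Proof.
elim: t => [j|a IHa b IHb|a IHa|] /=; last 3 first.
- by rewrite IHa IHb -big_split /=; apply: eq_bigr => i _; rewrite !mulrnDr opprD addrACA.
- by rewrite IHa -sumrN; apply: eq_bigr => i _; rewrite opprB.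
- by rewrite big1 // => i _; rewrite subrr.
have [je|je] := ltnP j (size e).
  rewrite (bigD1 (Ordinal je)) //= eqxx mulr1n mulr0n subr0 big1 ?addr0 // => i.
  rewrite -val_eqE /= => /negPf ->; by rewrite mulr0n subr0.
rewrite nth_default // big1 // => i _.
by rewrite ltn_eqF ?mulr0n ?subr0 // (leq_trans (ltn_ord i)).
Qed.

(** Distributing products in a noncommutative ring leaves an identity of the additive group with the
    products as atoms. Comparing net multiplicities, crossed to stay in [nat], settles it by
    computation; this is the soundness of [abel]. *)
Lemma zeval_eq (V : zmodType) (e : seq V) (t1 t2 : zexp) :
  all (fun i => (zcoef t1 i).1 + (zcoef t2 i).2 == (zcoef t2 i).1 + (zcoef t1 i).2)%N
    (iota 0 (size e)) -> zeval e t1 = zeval e t2.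
Proof.
move=> /allP H; rewrite !zevalE; apply: eq_bigr => i _.
have /H/eqP E : (i : nat) \in iota 0 (size e) by rewrite mem_iota leq0n add0n ltn_ord.
apply/eqP; rewrite subr_eq addrAC eq_sym subr_eq -!mulrnDr.
by rewrite E eq_refl.
Qed.

Ltac zlookup x l :=
  match l with
  | ?y :: _ => let _ := match goal with _ => unify x y end in constr:(O)
  | _ :: ?l' => let n := zlookup x l' in constr:(S n)
  end.
Ltac zmember x l :=
  match l with
  | ?y :: _ => let _ := match goal with _ => unify x y end in constr:(true)
  | _ :: ?l' => zmember x l'
  | @nil _ => constr:(false)
  end.
Ltac zatoms t l :=
  lazymatch t with
  | (?a + ?b)%R => let l1 := zatoms a l in zatoms b l1
  | (- ?a)%R => zatoms a l
  | 0%R => l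
  | _ => lazymatch zmember t l with true => l | false => constr:(t :: l) end
  end.
Ltac zreify t l :=
  lazymatch t with
  | (?a + ?b)%R => let x := zreify a l in let y := zreify b l in constr:(ZA x y)
  | (- ?a)%R => let x := zreify a l in constr:(ZN x)
  | 0%R => constr:(Z0)
  | _ => let n := zlookup t l in constr:(ZV n)
  end.
Ltac abel :=
  lazymatch goal with
  | |- @eq ?V ?a ?b =>
    let l0 := zatoms a (@nil V) in let l := zatoms b l0 in
    let x := zreify a l in let y := zreify b l in
    apply: (@zeval_eq _ l x y); vm_compute; reflexivity
  end.

(** * Positivity in unital C*-algebras *)

Lemma bernoulli (R : realType) (y : R) (m : nat) :
  0 <= y -> 1 + m%:R * y <= (1 + y) ^+ m.
Proof.
move=> y0; elim: m => [|m IH]; first by rewrite mul0r addr0 expr0.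
rewrite exprS; apply: le_trans (ler_wpM2l _ IH); last by lra.
have m0 : 0 <= m%:R :> R by [].
by rewrite -natr1; nra.
Qed.

(** If [x > r], write [x / r = 1 + y]. Squaring Bernoulli's bound at [2 ^ j] gives growth quadratic
    in [2 ^ j], against a linear factor on the right. Exponents are powers of two because the
    C*-identity computes the norms of such powers directly. *)
Lemma le_of_pow2_growth (R : realType) (x r C D : R) :
  0 <= x -> 0 <= r ->
  (forall j : nat, x ^+ (2 ^ j) <= (C + (2 ^ j)%:R * D) * r ^+ (2 ^ j)) ->
  x <= r.
Proof.
move=> x0 r0 H; rewrite leNgt; apply/negP => rx.
have xp : 0 < x by apply: le_lt_trans rx.
have [r_eq0|rn0] := eqVneq r 0.
  by have := H 0%N; rewrite expn0 !expr1 r_eq0 mulr0 leNgt xp.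
have rp : 0 < r by rewrite lt_def rn0.
pose y := x / r - 1.
have yp : 0 < y by rewrite subr_gt0 ltr_pdivlMr // mul1r.
have xE : x = r * (1 + y) by rewrite /y addrC subrK mulrC divfK.
have bern (m : nat) := bernoulli m (ltW yp).
have {}H (j : nat) : (1 + (2 ^ j)%:R * y) ^+ 2 <= C + (2 ^ j.+1)%:R * D.
  have := H j.+1; rewrite {1}xE exprMn mulrC ler_pM2r ?exprn_gt0 // => H'.
  apply: le_trans H'; rewrite expnSr exprM lerXn2r ?nnegrE ?bern //.
    by rewrite addr_ge0 // mulr_ge0 // ltW.
  by rewrite exprn_ge0 // addr_ge0 // ltW.
have [k] : exists k : nat, (`|C| + 2 * `|D|) / y ^+ 2 < k%:R.
  by exists (Num.bound ((`|C| + 2 * `|D|) / y ^+ 2)); apply: archi_boundP;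
     rewrite divr_ge0 ?sqr_ge0 ?addr_ge0 ?mulr_ge0.
rewrite ltr_pdivrMr ?exprn_gt0 // => Hk.
have := H k; rewrite expnS natrM; set n := (2 ^ k)%:R : R => Hn.
have kn : k%:R <= n by rewrite /n ler_nat ltnW // ltn_expl.
have n1 : 1 <= n by rewrite /n ler1n expn_gt0.
have CC := ler_norm C; have DD := ler_norm D.
have C0 := normr_ge0 C; have D0 := normr_ge0 D.
have y20 : 0 < y ^+ 2 by rewrite exprn_gt0.
have : n * (`|C| + 2 * `|D|) < n * (n * y ^+ 2).
  rewrite ltr_pM2l; last by lra.
  by apply: lt_le_trans Hk _; rewrite ler_pM2r.
nra.
Qed.

Lemma le_epsC (R : realType) (x y C : R) :
  0 <= C -> (forall e, 0 < e -> x <= y + C * e) -> x <= y.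
Proof.
move=> C0 H; apply/ler_addgt0Pr => e e0.
have C1 : 0 < C + 1 by lra.
apply: le_trans (H (e / (C + 1)) _) _; first by rewrite divr_gt0.
rewrite lerD2l mulrA ler_pdivrMr // mulrC ler_pM2l //; lra.
Qed.

(** The order arguments need only real scalars and a central square root of [-1]. Completeness is
    asked only along geometric sequences, as in the square root iteration, and yields two
    consecutive terms near the limit so that a fixed point equation can be checked. *)
Record unital_cstar (R : realType) (U : nzRingType) := UnitalCStar {
  ust : U -> U;
  unm : U -> R;
  usc : {rmorphism R -> U};
  uim : U;
  ustK : forall x, ust (ust x) = x;
  ustD : forall x y, ust (x + y) = ust x + ust y;
  ustM : forall x y, ust (x * y) = ust y * ust x;
  ust_sc : forall r, ust (usc r) = usc r;
  ust_im : ust uim = - uim;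
  usc_comm : forall r x, usc r * x = x * usc r;
  uim_comm : forall x, uim * x = x * uim;
  uim_sqr : uim * uim = -1;
  unm_ge0 : forall x, 0 <= unm x;
  unmD : forall x y, unm (x + y) <= unm x + unm y;
  unmM : forall x y, unm (x * y) <= unm x * unm y;
  unm_sc : forall r, unm (usc r) = `|r|;
  unm_star : forall x, unm (ust x * x) = unm x ^+ 2;
  unm_eq0 : forall x, unm x = 0 -> x = 0;
  unm_complete : forall (u : nat -> U) (C r : R), 0 <= r < 1 ->
    (forall n, unm (u n.+1 - u n) <= C * r ^+ n) ->
    exists l, forall e, 0 < e -> exists n, unm (u n.+1 - l) <= e /\ unm (u n - l) <= e
}.

Section unital_positivity.
Context (R : realType) (U : nzRingType) (W : unital_cstar R U).
Implicit Types (x y z h X Y : U) (r t e : R).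
Local Notation st := (ust W).
Local Notation N := (unm W).
Local Notation sc := (usc W).
Local Notation im := (uim W).

Lemma ust0 : st 0 = 0.
Proof. by apply: (addrI (st 0)); rewrite -ustD !addr0. Qed.

Lemma ustN x : st (- x) = - st x.
Proof. by apply/eqP; rewrite eq_sym -subr_eq0 -opprD -ustD subrr ust0 oppr0. Qed.

Lemma ust1 : st 1 = 1.
Proof. by rewrite -(rmorph1 sc) ust_sc. Qed.

Lemma ustX x n : st (x ^+ n) = st x ^+ n.
Proof. by elim: n => [|n IH]; rewrite ?ust1 // exprS ustM IH exprSr. Qed.

Lemma unm1 : N 1 = 1.
Proof. by rewrite -(rmorph1 sc) unm_sc normr1. Qed.

Lemma unm0 : N 0 = 0.
Proof. by rewrite -(rmorph0 sc) unm_sc normr0. Qed.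

Lemma unm_st x : N (st x) = N x.
Proof.
suff H z : N z <= N (st z) by apply/le_anti; rewrite H -{2}(ustK W x) H.
have [->|z0] := eqVneq (N z) 0; first exact: unm_ge0.
have zp : 0 < N z by rewrite lt_def z0 unm_ge0.
by rewrite -(ler_pM2r zp) -expr2 -(unm_star W); apply: unmM.
Qed.

Lemma unm_scM r x : N (sc r * x) = `|r| * N x.
Proof.
have H s y : N (sc s * y) <= `|s| * N y by rewrite -(unm_sc W); apply: unmM.
apply/le_anti; rewrite H /=.
have [->|r0] := eqVneq r 0; first by rewrite normr0 mul0r unm_ge0.
have xE : x = sc r^-1 * (sc r * x).
  by rewrite mulrA -rmorphM mulVf // rmorph1 mul1r.
rewrite [X in _ * N X <= _]xE; apply: le_trans (ler_wpM2l _ (H _ _)) _ => //.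
by rewrite mulrA -normrM mulfV // normr1 mul1r.
Qed.

Lemma unmN x : N (- x) = N x.
Proof.
by rewrite -mulN1r -(rmorph1 sc) -rmorphN unm_scM normrN normr1 mul1r.
Qed.

Lemma unmB x y : N (x - y) <= N x + N y.
Proof. by rewrite -(unmN y); apply: unmD. Qed.

Lemma unm_dist x y z : N (x - z) <= N (x - y) + N (y - z).
Proof. by rewrite -{1}(subrK y x) -addrA; apply: unmD. Qed.

Lemma unm_distC x y : N (x - y) = N (y - x).
Proof. by rewrite -unmN opprB. Qed.

Lemma unm_le_eps x C : 0 <= C -> (forall e, 0 < e -> N x <= C * e) -> x = 0.
Proof.
move=> C0 H; apply: (@unm_eq0 _ _ W); apply/le_anti; rewrite unm_ge0 andbT.
by apply: (le_epsC C0) => e /H; rewrite add0r.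
Qed.

Lemma unmX_pow2 x j : st x = x -> N (x ^+ (2 ^ j)) = N x ^+ (2 ^ j).
Proof.
move=> sx; elim: j => [|j IH]; first by rewrite expn0 !expr1.
by rewrite expnSr exprM exprM -IH expr2 -(unm_star W) ustX sx.
Qed.

Lemma unmX_le x n : N (x ^+ n) <= N x ^+ n.
Proof.
elim: n => [|n IH]; first by rewrite !expr0 unm1.
by rewrite !exprS; apply: le_trans (unmM W _ _) _; exact: ler_wpM2l (unm_ge0 W _) _ _ IH.
Qed.

Lemma unmX x n : st x = x -> N (x ^+ n) = N x ^+ n.
Proof.
move=> sx; apply/le_anti; rewrite unmX_le /=.
have [x0|x0] := eqVneq (N x) 0.
  rewrite x0; case: n => [|n]; first by rewrite !expr0 unm1.
  by rewrite expr0n /= unm_ge0.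
have xp : 0 < N x by rewrite lt_def x0 unm_ge0.
have ln : (n <= 2 ^ n)%N by rewrite ltnW // ltn_expl.
have pp : 0 < N x ^+ (2 ^ n - n) by rewrite exprn_gt0.
rewrite -(ler_pM2l pp) -exprD subnK // -unmX_pow2 // -{1}(subnK ln) exprD.
by apply: le_trans (unmM W _ _) _; exact: ler_wpM2r (unm_ge0 W _) _ _ (unmX_le _ _).
Qed.

(** [m] is the fixed point of [x |-> (b + x^2) / 2], iterated from [0]: the ball of radius [q = |b|]
    is stable and the map is a [q]-contraction on it. The iterates are polynomials in [b], hence the
    commutation clause. *)
Lemma usqrt1B (b : U) : st b = b -> N b < 1 ->
  exists m, [/\ st m = m, (1 - m) * (1 - m) = 1 - b &
    forall z, z * b = b * z -> z * m = m * z].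
Proof.
move=> sb b1; set q := N b; have q0 : 0 <= q := unm_ge0 W b.
pose f x := sc (2^-1) * (b + x * x).
pose u n := iter n f 0.
have half0 : `|2^-1| = 2^-1 :> R by rewrite ger0_norm ?invr_ge0.
have fB x y : N (f x - f y) <= 2^-1 * ((N x + N y) * N (x - y)).
  rewrite /f -mulrBr unm_scM half0 ler_pM2l ?invr_gt0 //.
  have -> : b + x * x - (b + y * y) = x * (x - y) + (x - y) * y.
    by rewrite opprD addrACA subrr add0r mulrBr mulrBl addrA subrK.
  apply: le_trans (unmD W _ _) _; rewrite [leRHS]mulrDl.
  by apply: lerD; [apply: unmM | rewrite mulrC; apply: unmM].
have uq n : N (u n) <= q.
  elim: n => [|n IH]; first by rewrite /= unm0.
  rewrite /= {1}/f unm_scM half0.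
  have := unmD W b (u n * u n); have := unmM W (u n) (u n); rewrite -/(u n) -/q.
  have := unm_ge0 W (u n); move: b1; rewrite -/q; nra.
have ud n : N (u n.+1 - u n) <= 1 * q ^+ n.
  elim: n => [|n IH].
    by rewrite expr0 mulr1 subr0 (le_trans (uq 1%N)) // ltW.
  have := fB (u n.+1) (u n); rewrite -[f (u n.+1)]/(u n.+2) -[f (u n)]/(u n.+1).
  move=> H; apply: le_trans H _; rewrite exprS.
  have := uq n.+1; have := uq n; have := unm_ge0 W (u n.+1 - u n).
  have := unm_ge0 W (u n); have := unm_ge0 W (u n.+1).
  have : 0 <= q ^+ n by rewrite exprn_ge0.
  nra.
have q01 : 0 <= q < 1 by rewrite q0.
have [m mlim] := unm_complete q01 ud.
have comm z n : z * b = b * z -> z * u n = u n * z.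
  move=> zb; elim: n => [|n IH]; first by rewrite /= mulr0 mul0r.
  rewrite /= /f mulrA -usc_comm -!mulrA; congr (_ * _).
  by rewrite mulrDr mulrDl zb mulrA IH -mulrA IH mulrA.
have su n : st (u n) = u n.
  elim: n => [|n IH]; first exact: ust0.
  by rewrite /= /f ustM ustD sb ustM IH ust_sc usc_comm.
have mE : m = f m.
  apply/eqP; rewrite -subr_eq0; apply/eqP.
  apply: (@unm_le_eps _ (1 + 2^-1 * (q + N m))).
    by have := unm_ge0 W m; lra.
  move=> e /mlim[n [h1 h2]].
  have h3 : (N (u n) + N m) * N (u n - m) <= (q + N m) * e.
    by rewrite ler_pM ?addr_ge0 ?unm_ge0 // lerD2r.
  have := unm_dist m (u n.+1) (f m); rewrite (unm_distC m (u _)).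
  have := fB (u n) m; rewrite -[f (u n)]/(u n.+1).
  lra.
exists m; split.
- apply/eqP; rewrite -subr_eq0; apply/eqP; apply: (@unm_le_eps _ 2) => // e /mlim[n [_ h]].
  have := unm_dist (st m) (u n) m; rewrite -{1}(su n) -ustN -ustD unm_st (unm_distC m); lra.
- have E : m + m = b + m * m.
    rewrite {1 2}mE /f -mulrDl -rmorphD.
    by rewrite (_ : 2^-1 + 2^-1 = 1) ?rmorph1 ?mul1r //; lra.
  have : b = m + m - m * m by rewrite E addrK.
  move=> ->; rewrite mulrBl mul1r mulrBr mulr1 !opprB opprD.
  abel.
- move=> z /comm zu; apply/eqP; rewrite -subr_eq0; apply/eqP.
  apply: (@unm_le_eps _ (2 * N z)); first by rewrite mulr_ge0 // unm_ge0.
  move=> e /mlim[n [_ h]].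
  have -> : z * m - m * z = (u n - m) * z - z * (u n - m).
    by rewrite mulrBl mulrBr zu; abel.
  have := unmB ((u n - m) * z) (z * (u n - m)).
  have := unmM W (u n - m) z; have := unmM W z (u n - m).
  have : N z * N (u n - m) <= N z * e by rewrite ler_wpM2l ?unm_ge0.
  lra.
Qed.

Definition upos X := st X = X /\ exists t, 0 <= t /\ N (sc t - X) <= t.

Lemma upos_ge X s : upos X -> exists t, s <= t /\ N (sc t - X) <= t.
Proof.
move=> [_ [t [t0 Ht]]]; exists (t + `|s|); split.
  by have := ler_norm s; lra.
have -> : sc (t + `|s|) - X = (sc t - X) + sc `|s| by rewrite rmorphD addrAC.
by have := unmD W (sc t - X) (sc `|s|); rewrite unm_sc normr_id; lra.
Qed.

Lemma uposD X Y : upos X -> upos Y -> upos (X + Y).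
Proof.
move=> [sX [t [t0 Ht]]] [sY [u [u0 Hu]]]; split; first by rewrite ustD sX sY.
exists (t + u); split; first exact: addr_ge0.
rewrite rmorphD opprD addrACA.
by apply: le_trans (unmD W _ _) _; apply: lerD.
Qed.

Lemma uposZ r X : 0 <= r -> upos X -> upos (sc r * X).
Proof.
move=> r0 [sX [t [t0 Ht]]]; split; first by rewrite ustM sX ust_sc usc_comm.
exists (r * t); split; first exact: mulr_ge0.
by rewrite rmorphM -mulrBr unm_scM ger0_norm // ler_wpM2l.
Qed.

Lemma upos_scB r X : st X = X -> N X <= r -> upos (sc r - X).
Proof.
move=> sX Xr; split; first by rewrite ustD ustN ust_sc sX.
by exists r; split; [apply: le_trans Xr; apply: unm_ge0 | rewrite opprB addrC subrK].
Qed.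

(** [X + e = (t + e) (1 - b)] with [b = (t - X) / (t + e)]; the shift by [e] forces [|b| < 1], as
    the iteration requires. *)
Lemma upos_sqrt X e : upos X -> 0 < e ->
  exists Y, [/\ st Y = Y, Y * Y = X + sc e &
    forall z, z * X = X * z -> z * Y = Y * z].
Proof.
move=> [sX [t [t0 Ht]]] e0; have te : 0 < t + e by lra.
pose b := sc (t + e)^-1 * (sc t - X).
have sb : st b = b by rewrite ustM ustD ustN !ust_sc sX -usc_comm.
have b1 : N b < 1.
  rewrite unm_scM gtr0_norm ?invr_gt0 // mulrC ltr_pdivrMr // mul1r; lra.
have [m [sm mE mC]] := usqrt1B sb b1.
pose s := Num.sqrt (t + e).
have ss : s * s = t + e by rewrite -expr2 sqr_sqrtr // ltW.
exists (sc s * (1 - m)); split.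
- by rewrite ustM ustD ustN ust1 sm ust_sc usc_comm.
- rewrite -mulrA [(1 - m) * _]mulrA -usc_comm !mulrA -rmorphM ss -mulrA mE.
  rewrite mulrBr mulr1 mulrA -rmorphM mulfV ?gt_eqF // rmorph1 mul1r.
  by rewrite rmorphD; abel.
- move=> z zX; rewrite mulrA -usc_comm -!mulrA; congr (_ * _).
  rewrite mulrBr mulrBl mulr1 mul1r mC // /b mulrA -usc_comm -!mulrA.
  by rewrite mulrBr mulrBl zX -usc_comm.
Qed.

(* [g + i k] is, up to a scalar, unitary when [g] and [k] commute and
   [g^2 + k^2] is a scalar; this replaces the spectral theorem. *)
Lemma unm_comm_sumsq g k M : st g = g -> st k = k -> g * k = k * g ->
  N (g * g + k * k) <= M -> N g ^+ 2 <= M.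
Proof.
move=> sg sk gk gM; pose u := g + im * k.
have su : st u = g - im * k.
  by rewrite ustD ustM sg sk ust_im mulrN uim_comm.
have uu : st u * u = g * g + k * k.
  have e1 : im * k * (im * k) = - (k * k).
    by rewrite -mulrA [k * _]mulrA -uim_comm !mulrA uim_sqr mulN1r mulNr.
  have e2 : g * (im * k) = im * k * g by rewrite mulrA -uim_comm -!mulrA gk.
  by rewrite su mulrDr !mulrBl e1 e2; abel.
have Nu : N u ^+ 2 <= M by rewrite -(unm_star W) uu.
have gg : sc 2 * g = u + st u.
  by rewrite su rmorphD rmorph1 mulrDl mul1r addrACA subrr addr0.
have Ng : N g <= N u.
  by have := unmD W u (st u); rewrite unm_st -gg unm_scM ger0_norm //; lra.
by apply: le_trans Nu; rewrite lerXn2r ?nnegrE ?unm_ge0.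
Qed.

(** Scale [h] to [g] of norm below 1 and let [1 - m] be the root of [1 - g^2]. Then
    [(1 - m)^2 + g^2 = 1] with commuting terms, so [|1 - m| <= 1] and [|1 - g^2| <= 1]; scaling
    back, [t = c^2] is a witness. *)
Lemma upos_sqr h : st h = h -> upos (h * h).
Proof.
move=> sh; split; first by rewrite ustM sh.
pose c := N h + 1; have c0 : 0 < c by have := unm_ge0 W h; rewrite /c; lra.
pose g := sc c^-1 * h.
have sg : st g = g by rewrite ustM sh ust_sc -usc_comm.
have Ng : N g < 1.
  rewrite unm_scM gtr0_norm ?invr_gt0 // mulrC ltr_pdivrMr // mul1r /c; lra.
have sb : st (g * g) = g * g by rewrite ustM sg.
have Nb : N (g * g) < 1.
  by have := unmM W g g; have := unm_ge0 W g; nra.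
have [m [sm mE mC]] := usqrt1B sb Nb.
have gm : g * m = m * g by apply: mC; rewrite mulrA.
have := @unm_comm_sumsq (1 - m) g 1.
rewrite mE subrK unm1 ustD ustN ust1 sm mulrBl mulrBr mul1r mulr1 gm.
move=> /(_ erefl sg erefl (lexx _)) H.
exists (c * c); split; first by rewrite mulr_ge0 // ltW.
have -> : sc (c * c) - h * h = sc (c * c) * (1 - g * g).
  rewrite mulrBr mulr1; congr (_ - _).
  rewrite /g -mulrA [h * (sc _ * _)]mulrA -usc_comm -!mulrA 2!mulrA -rmorphM.
  rewrite -[sc _ * h * h]mulrA [sc (c * c) * _]mulrA -rmorphM -invfM.
  by rewrite mulfV ?rmorph1 ?mul1r // mulf_neq0 // gt_eqF.
have cc0 : 0 < c * c by exact: mulr_gt0.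
rewrite unm_scM gtr0_norm // -mE ger_pMr //.
by apply: le_trans (unmM W _ _) _; rewrite -expr2.
Qed.

(** [X + e] and [r - X + e] have commuting square roots whose squares add up to [r + 2e]. Hence
    [|X + e| <= r + 2e], and removing [e] costs one more [e], whence the factor [3]. *)
Lemma upos_unm_le X r : 0 <= r -> upos X -> upos (sc r - X) -> N X <= r.
Proof.
move=> r0 pX pY; apply: (@le_epsC _ _ _ 3) => // e e0.
have [g [sg gE gC]] := upos_sqrt pX e0.
have [k [sk kE kC]] := upos_sqrt pY e0.
have gk : g * k = k * g.
  apply: kC; rewrite mulrBr mulrBl usc_comm; congr (_ - _).
  by rewrite gC.
have S : g * g + k * k = sc (r + 2 * e).
  by rewrite gE kE (_ : r + 2 * e = r + e + e) ?rmorphD; [abel|lra].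
have Ng : N g ^+ 2 <= r + 2 * e.
  by apply: (unm_comm_sumsq sg sk gk); rewrite S unm_sc ger0_norm //; lra.
have -> : X = g * g - sc e by rewrite gE addrK.
have := unmB (g * g) (sc e); rewrite unm_sc ger0_norm ?(ltW e0) // => H1.
have : N (g * g) = N g ^+ 2 by rewrite -{1}sg unm_star.
lra.
Qed.

(* [(s + yy^* )^n = s^n + y S_n y^*] with [|S_n| <= n t^n] when [|s + y^*y| <= t];
   for the powers [n = 2^j] the left-hand side has norm [|s + yy^*|^n]. *)
Lemma upos_swap y : upos (1 - st y * y) -> upos (1 - y * st y).
Proof.
move=> pX; have [t [t2 Ht]] := @upos_ge _ 2 pX.
split; first by rewrite ustD ustN ust1 ustM ustK.
exists t; split; first lra.
pose s := t - 1; have s0 : 0 <= s by rewrite /s; lra.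
have E z : sc t - (1 - z) = sc s + z.
  by rewrite /s rmorphB rmorph1; abel.
rewrite !E in Ht *; set a := st y * y in Ht; set z := y * st y.
pose S n := iteri n (fun i x => sc (s ^+ i) + x * (sc s + a)) 0.
have SS n : S n.+1 = sc (s ^+ n) + S n * (sc s + a) by [].
have ya : st y * (sc s + z) = (sc s + a) * st y.
  by rewrite mulrDr mulrDl -usc_comm !mulrA.
have HX n : (sc s + z) ^+ n = sc (s ^+ n) + y * S n * st y.
  elim: n => [|n IH]; first by rewrite !expr0 rmorph1 mulr0 mul0r addr0.
  rewrite exprSr IH mulrDl mulrDr -rmorphM -exprSr -addrA; congr (_ + _).
  rewrite SS [in RHS]mulrDr [in RHS]mulrDl; congr (_ + _).
    by rewrite -usc_comm /z mulrA.
  by rewrite -!mulrA ya.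
have HS n : N (S n) <= n%:R * t ^+ n.
  elim: n => [|n IH]; first by rewrite /S /= unm0 mul0r.
  rewrite SS -natr1 mulrDl mul1r [leRHS]addrC.
  apply: le_trans (unmD W _ _) _; apply: lerD; last first.
    apply: le_trans (unmM W _ _) _; rewrite exprSr mulrA.
    by apply: ler_pM; rewrite ?unm_ge0.
  rewrite unm_sc ger0_norm ?exprn_ge0 //.
  apply: le_trans (_ : t ^+ n <= _); first by rewrite lerXn2r ?nnegrE //; rewrite /s; lra.
  by rewrite exprS ler_peMl ?exprn_ge0 //; lra.
apply: (@le_of_pow2_growth _ _ _ 1 (N y ^+ 2)); [exact: unm_ge0|lra|].
move=> j; set n := (2 ^ j)%N.
rewrite -unmX_pow2 -/n; last by rewrite ustD ust_sc ustM ustK.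
rewrite HX; apply: le_trans (unmD W _ _) _; rewrite mulrDl mul1r; apply: lerD.
  rewrite unm_sc ger0_norm ?exprn_ge0 // lerXn2r ?nnegrE //; rewrite /s; lra.
apply: le_trans (unmM W _ _) _; rewrite unm_st.
have := unmM W y (S n); have := HS n; have := unm_ge0 W y; have := unm_ge0 W (S n).
set p := N y; set q := N (S n); set w := N (y * S n) => q0 p0 qn wpq.
have -> : n%:R * p ^+ 2 * t ^+ n = p * (n%:R * t ^+ n) * p by ring.
apply: ler_wpM2r => //; apply: le_trans wpq _; exact: ler_wpM2l.
Qed.

(* Kelley-Vaught theorem.  If [mu = 1 - h] had norm > 1, where [h = x^*x], then
   [h mu^(2n)] would grow with [n]; but [y = x mu^n] satisfies
   [y^*y = h mu^(2n) <= 1], so [yy^* <= 1] and [y^*y >= -yy^* >= -1]. *)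
Lemma upos_star x : upos (st x * x).
Proof.
wlog x1 : x / N x <= 1 => [H|].
  pose c := N x + 1; have c0 : 0 < c by have := unm_ge0 W x; rewrite /c; lra.
  have -> : st x * x = sc (c * c) * (st (sc c^-1 * x) * (sc c^-1 * x)).
    rewrite ustM ust_sc -mulrA [sc _ * (sc _ * x)]mulrA -rmorphM.
    rewrite [st x * (sc _ * _)]mulrA -usc_comm -[sc _ * st x * x]mulrA mulrA -rmorphM.
    by rewrite -invfM mulfV ?rmorph1 ?mul1r // mulf_neq0 // gt_eqF.
  apply: uposZ; first by rewrite mulr_ge0 // ltW.
  apply: H; rewrite unm_scM gtr0_norm ?invr_gt0 // mulrC ler_pdivrMr // mul1r /c; lra.
have [h hE] : exists h, h = st x * x by exists (st x * x).
rewrite -hE; have sh : st h = h by rewrite hE ustM ustK.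
have h1 : N h <= 1 by rewrite hE unm_star exprn_ile1 ?unm_ge0.
have [mu muE] : exists mu, mu = 1 - h by exists (1 - h).
have smu : st mu = mu by rewrite muE ustD ustN ust1 sh.
have pmu : upos mu.
  by have := upos_scB sh h1; rewrite rmorph1 muE.
have hmu : h * mu = mu * h by rewrite muE mulrBr mulrBl mulr1 mul1r.
have [Y [sY YE YC]] := upos_sqrt pmu ltr01; rewrite rmorph1 in YE.
have hY : h * Y = Y * h by exact: YC.
have hX n : h * mu ^+ n = mu ^+ n * h by apply: (commrX n hmu).
have YX n : mu ^+ n * Y = Y * mu ^+ n by apply: YC; rewrite -exprS exprSr.
(* As [1 - mu = h], passing from [n] to [n + 1] adds [h mu^(2n) (1 - mu^2) = h^2 mu^(2n) (1 + mu)],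
   the square of the self-adjoint element [h mu^n Y]. *)
have pn n : upos (1 - h * (mu ^+ n * mu ^+ n)).
  elim: n => [|n IH]; first by rewrite !expr0 !mulr1 -muE.
  have -> : 1 - h * (mu ^+ n.+1 * mu ^+ n.+1) =
      (1 - h * (mu ^+ n * mu ^+ n)) + (h * mu ^+ n * Y) * (h * mu ^+ n * Y).
    have -> : h * mu ^+ n * Y * (h * mu ^+ n * Y) =
        h * (h * (mu ^+ n * mu ^+ n) * (Y * Y)).
      rewrite -!mulrA; congr (h * _); rewrite !mulrA; congr (_ * Y).
      by rewrite -[_ * Y * h]mulrA -hY mulrA -hX -!mulrA YX.
    rewrite YE; have -> : h * (mu ^+ n * mu ^+ n) * (mu + 1) =
        mu ^+ n * mu ^+ n * (1 - mu * mu).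
      rewrite mulrA hX -(mulrA _ h) hX mulrA -mulrA; congr (_ * _).
      by rewrite muE !(mulrBl, mulrBr, mulrDr, mulr1, mul1r); abel.
    have -> : mu ^+ n.+1 * mu ^+ n.+1 = mu ^+ n * mu ^+ n * (mu * mu).
      by rewrite -(expr2 mu) -!exprD addnS addSn addn2.
    by rewrite mulrBr mulr1 mulrBr; abel.
  apply: uposD => //; apply: upos_sqr.
  by rewrite !ustM ustX sY smu sh -hX mulrA -hY -mulrA -YX mulrA.
(* From [0 <= 1 + y^* y <= 2] the norm of [1 + y^* y] is at most [2]; subtracting [1] gives [3]. *)
have bnd n : N (h * (mu ^+ n * mu ^+ n)) <= 3.
  pose y := x * mu ^+ n.
  have yy : st y * y = h * (mu ^+ n * mu ^+ n).
    by rewrite /y ustM ustX smu mulrA -(mulrA _ (st x)) -hE -hX -mulrA.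
  have p1 : upos (1 - y * st y) by apply: upos_swap; rewrite yy.
  clearbody y.
  (* This is half of [u^2 + v^2] with [u], [v] self-adjoint, so its positivity does not rest on the
     theorem being proved. *)
  have p2 : upos (st y * y + y * st y).
    pose u := y + st y; pose v := im * (y - st y).
    have su : st u = u by rewrite /u ustD ustK addrC.
    have sv : st v = v by rewrite /v ustM ustD ustN ustK ust_im mulrN -uim_comm -mulrN opprB.
    have -> : st y * y + y * st y = sc 2^-1 * (u * u + v * v).
      have -> : v * v = - ((y - st y) * (y - st y)).
        by rewrite /v -mulrA [(_ - _) * (im * _)]mulrA -uim_comm !mulrA uim_sqr mulN1r mulNr.
      have -> : u * u - (y - st y) * (y - st y) = sc 2 * (st y * y + y * st y).
        rewrite rmorphD rmorph1 [RHS]mulrDl mul1r /u.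
        by rewrite !(mulrBl, mulrBr, mulrDl, mulrDr); abel.
      by rewrite mulrA -rmorphM mulVf ?pnatr_eq0 // rmorph1 mul1r.
    by apply: uposZ; [rewrite invr_ge0 | apply: uposD; apply: upos_sqr].
  have p3 : upos (1 + st y * y).
    have -> : 1 + st y * y = (1 - y * st y) + (st y * y + y * st y) by abel.
    exact: uposD.
  have p4 : upos (sc 2 - (1 + st y * y)).
    have -> : sc 2 - (1 + st y * y) = 1 - st y * y by rewrite rmorphD rmorph1; abel.
    by rewrite yy.
  have := upos_unm_le (ler0n R 2) p3 p4.
  have := unmB (1 + st y * y) 1; rewrite unm1 addrAC subrr add0r yy; lra.
have mu1 : N mu <= 1.
  rewrite leNgt; apply/negP => mu1.
  pose d := N mu - 1; have d0 : 0 < d by rewrite subr_gt0.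
  have ge1 n : 1 + n%:R * d <= N mu ^+ n.
    by have := bernoulli n (ltW d0); rewrite (_ : 1 + d = N mu) // /d addrC subrK.
  (* Since [h mu^k = mu^k - mu^(k+1)], its norm is at least [|mu|^(k+1) - |mu|^k = |mu|^k d]: norms
     of powers of a self-adjoint element are exact. *)
  have up n : N mu ^+ n * N mu ^+ n * d <= 3.
    have := bnd n; rewrite -!exprD; move: (n + n)%N => k bk.
    have : N (mu ^+ k) = N mu ^+ k by apply: unmX.
    have : N (mu ^+ k.+1) = N mu ^+ k.+1 by apply: unmX.
    have -> : mu ^+ k.+1 = mu ^+ k - h * mu ^+ k.
      by rewrite exprS {1}muE mulrBl mul1r.
    have := unmB (mu ^+ k) (h * mu ^+ k); rewrite exprSr /d; lra.
  have [k] : exists k : nat, 3 / d / d < k%:R.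
    exists (Num.bound (3 / d / d)); apply: archi_boundP.
    by rewrite !divr_ge0 // ltW.
  rewrite ltr_pdivrMr // ltr_pdivrMr // => kd.
  have kd0 : 0 <= k%:R * d by rewrite mulr_ge0 // ltW.
  have := up k; have := ge1 k; set a := N mu ^+ k => a1 a3.
  have : a * d <= a * a * d by rewrite ler_wpM2r ?(ltW d0) // ler_peMr; lra.
  have : k%:R * d * d <= a * d by rewrite ler_wpM2r ?(ltW d0) //; lra.
  lra.
by split=> //; exists 1; rewrite rmorph1 -muE.
Qed.

(** [|X + Y| - X] is the sum of [|X + Y| - (X + Y)] and [Y], both positive, so the scalar [|X + Y|]
    dominates [X]. *)
Lemma upos_unm_leD X Y : upos X -> upos Y -> N X <= N (X + Y).
Proof.
move=> pX pY; apply: upos_unm_le => //; first exact: unm_ge0.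
have sXY : st (X + Y) = X + Y by case: (uposD pX pY).
have := uposD (upos_scB sXY (lexx _)) pY.
by rewrite opprD addrA addrNK.
Qed.

End unital_positivity.

(** * Real-valued norms and completeness *)

Section real_norm.
Context (R : realType).

Definition cabs (l : R[i]) : R := complex.Re `|l|.

Lemma cabsE (l : R[i]) : `|l| = (cabs l)%:C.
Proof. by rewrite /cabs RRe_real // ger0_real. Qed.

Lemma cabs_ge0 l : 0 <= cabs l.
Proof. by rewrite -ler0c -cabsE. Qed.

Lemma cabsM l m : cabs (l * m) = cabs l * cabs m.
Proof. by apply: complexI; rewrite -cabsE normrM !cabsE rmorphM. Qed.

Lemma cabsD l m : cabs (l + m) <= cabs l + cabs m.
Proof. by rewrite -lecR rmorphD /= -!cabsE ler_normD. Qed.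

Lemma cabs_eq0 l : cabs l = 0 -> l = 0.
Proof. by move=> l0; apply/eqP; rewrite -normr_eq0 cabsE l0. Qed.

Lemma cabs_conj l : cabs l^* = cabs l.
Proof. by rewrite /cabs normcJ. Qed.

Lemma cabs_real (r : R) : cabs r%:C = `|r|.
Proof.
apply: complexI; rewrite -cabsE normc_def /= expr0n /= addr0.
by rewrite sqrtr_sqr.
Qed.

Lemma cabsX l n : cabs (l ^+ n) = cabs l ^+ n.
Proof. by apply: complexI; rewrite -cabsE normrX cabsE rmorphXn. Qed.

Lemma cabs_le_Re (l : R[i]) : `|complex.Re l| <= cabs l.
Proof. by rewrite -lecR -cabsE normc_ge_Re. Qed.

Lemma cabs_i : cabs 'i = 1.
Proof. by rewrite /cabs normc_def /= expr0n expr1n add0r sqrtr1. Qed.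

Lemma cabs_le_Im (l : R[i]) : `|complex.Im l| <= cabs l.
Proof.
have := cabs_le_Re (l * 'i); rewrite cabsM ReiNIm normrN => /le_trans; apply.
by rewrite cabs_i mulr1.
Qed.

Lemma cabs_le (l : R[i]) : cabs l <= `|complex.Re l| + `|complex.Im l|.
Proof.
rewrite {1}(complexE l); apply: le_trans (cabsD _ _) _.
by rewrite cabsM cabs_i mul1r !cabs_real.
Qed.

Section normed.
Context (V : normedModType R[i]).
Implicit Types x y : V.

Lemma rnormE x : `|x| = (rnorm x)%:C.
Proof. by rewrite /rnorm RRe_real // ger0_real. Qed.

Lemma rnorm_ge0 x : 0 <= rnorm x.
Proof. by rewrite -ler0c -rnormE. Qed.

Lemma rnormD x y : rnorm (x + y) <= rnorm x + rnorm y.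
Proof. by rewrite -lecR rmorphD /= -!rnormE ler_normD. Qed.

Lemma rnormZ l x : rnorm (l *: x) = cabs l * rnorm x.
Proof. by apply: complexI; rewrite -rnormE normrZ cabsE rnormE rmorphM. Qed.

Lemma rnormZr (r : R) x : 0 <= r -> rnorm (r%:C *: x) = r * rnorm x.
Proof. by move=> r0; rewrite rnormZ cabs_real ger0_norm. Qed.

Lemma rnormN x : rnorm (- x) = rnorm x.
Proof. by rewrite /rnorm normrN. Qed.

Lemma rnorm0 : rnorm (0 : V) = 0.
Proof. by rewrite /rnorm normr0. Qed.

Lemma rnorm_eq0 x : rnorm x = 0 -> x = 0.
Proof. by move=> x0; apply/eqP; rewrite -normr_eq0 rnormE x0. Qed.

Lemma rnorm_distC x y : rnorm (x - y) = rnorm (y - x).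
Proof. by rewrite -rnormN opprB. Qed.

Lemma rnorm_dist x y z : rnorm (x - z) <= rnorm (x - y) + rnorm (y - z).
Proof. by rewrite -{1}(subrK y x) -addrA; apply: rnormD. Qed.

Lemma rnorm_small_eq0 x C :
  0 <= C -> (forall e, 0 < e -> rnorm x <= C * e) -> x = 0.
Proof.
move=> C0 H; apply: rnorm_eq0; apply/le_anti; rewrite rnorm_ge0 andbT.
by apply: (le_epsC C0) => e /H; rewrite add0r.
Qed.

End normed.
End real_norm.

Lemma cauchy_seq_lim (K : numFieldType) (V : completeNormedModType K) (u : nat -> V) :
  (forall e : K, 0 < e -> exists n, forall k, (n <= k)%N -> `|u k - u n| <= e) ->
  exists l, forall e : K, 0 < e -> exists n, forall k, (n <= k)%N -> `|u k - l| <= e.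
Proof.
move=> H; have cu : cauchy (u @ \oo).
  apply: cauchy_exP => e e0.
  have e2 : 0 < e / 2 by rewrite divr_gt0.
  have [n Hn] := H _ e2; exists (u n).
  exists n => // k /= nk; rewrite -ball_normE /= distrC.
  by apply: le_lt_trans (Hn _ nk) _; rewrite gtr_pMr // invf_lt1 // ltr1n.
have ucv : cvg (u @ \oo) by apply: cauchy_cvg.
have [l /cvgrPdist_le ul] := (cvg_ex (u @ \oo)).1 ucv.
exists l => e e0; have [n _ Hn] := ul _ e0; exists n => k nk.
by rewrite distrC; apply: Hn.
Qed.

Section geometric.
Context (R : realType).
Implicit Types (C r e : R).

(** The factor [1 - r] makes the geometric tail [C r^n / (1 - r)] at most [e]. *)
Lemma geometric_eventually C r : 0 <= C -> 0 <= r < 1 ->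
  forall e, 0 < e -> exists n : nat, C * r ^+ n <= e * (1 - r).
Proof.
move=> C0 /andP[r0 r1] e e0.
have [->|rn0] := eqVneq r 0.
  by exists 1%N; rewrite expr1 mulr0 subr0 mulr1 ltW.
have rp : 0 < r by rewrite lt_def rn0.
pose d := r^-1 - 1; have d0 : 0 < d by rewrite subr_gt0 invf_gt1.
have bern (n : nat) : n%:R * d <= r^-1 ^+ n.
  by have := bernoulli n (ltW d0); rewrite (_ : 1 + d = r^-1); [lra | rewrite /d addrC subrK].
have ed : 0 < e * (1 - r) * d by rewrite !mulr_gt0 // subr_gt0.
exists (Num.bound (C / (e * (1 - r) * d))).
set n := Num.bound _.
have : C / (e * (1 - r) * d) < n%:R by apply: archi_boundP; rewrite divr_ge0 // ltW.
rewrite ltr_pdivrMr // => Cn.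
have rn : 0 < r ^+ n by rewrite exprn_gt0.
have rrn : r^-1 ^+ n * r ^+ n = 1 by rewrite -exprMn mulVf // expr1n.
suff : C * r ^+ n <= e * (1 - r) * (r^-1 ^+ n * r ^+ n) by rewrite rrn mulr1.
rewrite mulrA ler_pM2r //; apply/ltW/(lt_le_trans Cn); rewrite mulrCA.
by rewrite ler_pM2l ?mulr_gt0 ?subr_gt0.
Qed.

Lemma geometric_cauchy (V : zmodType) (N : V -> R) (u : nat -> V) C r :
  N 0 = 0 -> (forall x y, N (x + y) <= N x + N y) -> 0 <= r < 1 ->
  (forall n, N (u n.+1 - u n) <= C * r ^+ n) ->
  forall e, 0 < e -> exists n, forall k, (n <= k)%N -> N (u k - u n) <= e.
Proof.
move=> N0 ND r01 H e e0; have [/andP[r0 r1] r1'] := (r01, r01).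
have [n Hn] := geometric_eventually (normr_ge0 C) r01 e0.
exists n; suff S k : N (u (n + k)%N - u n) * (1 - r) <= `|C| * r ^+ n * (1 - r ^+ k).
  move=> k nk; have := S (k - n)%N; rewrite subnKC // => {}S.
  have : `|C| * r ^+ n * (1 - r ^+ (k - n)) <= `|C| * r ^+ n.
    rewrite ler_piMr ?mulr_ge0 ?exprn_ge0 //.
    by rewrite lerBlDr lerDl exprn_ge0.
  move=> S2; have : N (u k - u n) * (1 - r) <= e * (1 - r) by lra.
  by rewrite ler_pM2r // subr_gt0.
elim: k => [|k IH]; first by rewrite addn0 subrr N0 mul0r expr0 subrr mulr0.
have := ND (u (n + k).+1 - u (n + k)%N) (u (n + k)%N - u n).
rewrite addrA subrK addnS => D1.
have D2 := H (n + k)%N; rewrite exprD in D2.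
have : C * (r ^+ n * r ^+ k) <= `|C| * (r ^+ n * r ^+ k).
  by rewrite ler_wpM2r ?ler_norm // mulr_ge0 ?exprn_ge0.
rewrite exprS => D3.
have : N (u (n + k).+1 - u n) * (1 - r) <=
   (`|C| * (r ^+ n * r ^+ k) + N (u (n + k)%N - u n)) * (1 - r).
  by rewrite ler_wpM2r //; lra.
lra.
Qed.

Lemma rnorm_complete (V : completeNormedModType R[i]) (u : nat -> V) :
  (forall e, 0 < e -> exists n, forall k, (n <= k)%N -> rnorm (u k - u n) <= e) ->
  exists l, forall e, 0 < e -> exists n, forall k, (n <= k)%N -> rnorm (u k - l) <= e.
Proof.
move=> H; have [|l Hl] := @cauchy_seq_lim R[i] V u.
  move=> e e0; have eE : e = (complex.Re e)%:C by rewrite RRe_real // gtr0_real.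
  have /H[n Hn] : 0 < complex.Re e by rewrite -ltcR -eE.
  by exists n => k /Hn; rewrite -lecR -rnormE -eE.
exists l => e e0; have /Hl[n Hn] : 0 < e%:C by rewrite ltcR.
by exists n => k /Hn; rewrite rnormE lecR.
Qed.

Lemma cabs_complete (u : nat -> R[i]) :
  (forall e, 0 < e -> exists n, forall k, (n <= k)%N -> cabs (u k - u n) <= e) ->
  exists l, forall e, 0 < e -> exists n, forall k, (n <= k)%N -> cabs (u k - l) <= e.
Proof.
move=> H.
have [|a Ha] := @cauchy_seq_lim R R (fun n => complex.Re (u n)).
  move=> e /H[n Hn]; exists n => k /Hn; apply: le_trans.
  by rewrite -(raddfB (@complex.Re R)); apply: cabs_le_Re.
have [|b Hb] := @cauchy_seq_lim R R (fun n => complex.Im (u n)).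
  move=> e /H[n Hn]; exists n => k /Hn; apply: le_trans.
  by rewrite -(raddfB (@complex.Im R)); apply: cabs_le_Im.
exists (a +i* b) => e e0; have e2 : 0 < e / 2 by lra.
have [n Hn] := Ha _ e2; have [m Hm] := Hb _ e2.
exists (maxn n m) => k; rewrite geq_max => /andP[/Hn h1 /Hm h2].
apply: le_trans (cabs_le _) _.
by move: h1 h2; case: (u k) => x y /=; lra.
Qed.

End geometric.

(** * The unitization *)

Definition unitization (R : realType) (A : cstarAlgType R) := (R[i] * A)%type.

Section unitization.
Context (R : realType) (A : cstarAlgType R).
Local Notation U := (unitization A).
Implicit Types (x y z : U) (a b c : A) (l m : R[i]).

HB.instance Definition _ := GRing.Zmodule.copy U (R[i] * A)%type.

Lemma cmul0 a : cmul a 0 = 0.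
Proof. by rewrite -(scale0r 0) cmulZr !scale0r. Qed.

Lemma cmul0l a : cmul 0 a = 0.
Proof. by rewrite -(scale0r 0) cmulZl !scale0r. Qed.

Lemma cmulNr a b : cmul a (- b) = - cmul a b.
Proof. by rewrite -scaleN1r cmulZr scaleN1r. Qed.

Lemma cmulNl a b : cmul (- a) b = - cmul a b.
Proof. by rewrite -scaleN1r cmulZl scaleN1r. Qed.

Lemma cstarZc l a : cstar (l *: a) = conjc l *: cstar a.
Proof. exact: cstarZ. Qed.

Lemma cstar0 : cstar (0 : A) = 0.
Proof. by rewrite -{1}(scale0r 0) cstarZc conjc0 scale0r. Qed.

Lemma cstarN a : cstar (- a) = - cstar a.
Proof. by apply/eqP; rewrite -addr_eq0 -cstarD addNr cstar0. Qed.

Lemma rnormM a b : rnorm (cmul a b) <= rnorm a * rnorm b.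
Proof. by rewrite -lecR rmorphM /= -!rnormE cnormM. Qed.

Lemma rnorm_cstarM a : rnorm (cmul (cstar a) a) = rnorm a ^+ 2.
Proof. by apply: complexI; rewrite -rnormE cnorm_star rnormE rmorphXn. Qed.

Lemma rnorm_cstar a : rnorm (cstar a) = rnorm a.
Proof.
suff H b : rnorm b <= rnorm (cstar b) by apply/le_anti; rewrite H -{2}(cstarK a) H.
have [->|b0] := eqVneq (rnorm b) 0; first exact: rnorm_ge0.
have bp : 0 < rnorm b by rewrite lt_def b0 rnorm_ge0.
by rewrite -(ler_pM2r bp) -expr2 -rnorm_cstarM; apply: rnormM.
Qed.

Definition un_mul x y : U := (x.1 * y.1, x.1 *: y.2 + y.1 *: x.2 + cmul x.2 y.2).
Definition un_one : U := (1, 0).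
Definition un_star x : U := (conjc x.1, cstar x.2).
Definition un_inj a : U := (0, a).
Definition un_act x b : A := x.1 *: b + cmul x.2 b.

Lemma un_eq x y : x.1 = y.1 -> x.2 = y.2 -> x = y.
Proof. by case: x => ? ?; case: y => ? ? /= -> ->. Qed.

Lemma un_mulA : associative un_mul.
Proof.
move=> x y z; apply: un_eq => /=; first exact: mulrA.
rewrite !(cmulDl, cmulDr, cmulZl, cmulZr, scalerDr, scalerA) cmulA.
by rewrite (mulrC z.1) (mulrC z.1); abel.
Qed.

Lemma un_mul1 : left_id un_one un_mul.
Proof.
move=> x; apply: un_eq => /=; first exact: mul1r.
by rewrite scale1r scaler0 addr0 cmul0l addr0.
Qed.

Lemma un_mulr1 : right_id un_one un_mul.
Proof.
move=> x; apply: un_eq => /=; first exact: mulr1.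
by rewrite scale1r scaler0 add0r cmul0 addr0.
Qed.

Lemma un_mulDl : left_distributive un_mul +%R.
Proof.
move=> x y z; apply: un_eq => /=; first exact: mulrDl.
by rewrite scalerDl scalerDr cmulDl; abel.
Qed.

Lemma un_mulDr : right_distributive un_mul +%R.
Proof.
move=> x y z; apply: un_eq => /=; first exact: mulrDr.
by rewrite scalerDl scalerDr cmulDr; abel.
Qed.

Lemma un_one_neq0 : un_one != 0.
Proof. by apply/eqP => -[] /eqP; rewrite oner_eq0. Qed.

HB.instance Definition _ := GRing.Zmodule_isNzRing.Build U
  un_mulA un_mul1 un_mulr1 un_mulDl un_mulDr un_one_neq0.

Lemma un_actM x y b : un_act (x * y) b = un_act x (un_act y b).
Proof.
rewrite /un_act /= !(cmulDl, cmulDr, cmulZl, cmulZr, scalerDr, scalerA) cmulA.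
by abel.
Qed.

Lemma un_actD x y b : un_act (x + y) b = un_act x b + un_act y b.
Proof. by rewrite /un_act /= scalerDl cmulDl; abel. Qed.

Lemma un_actZ x l b : un_act x (l *: b) = l *: un_act x b.
Proof. by rewrite /un_act cmulZr scalerDr !scalerA mulrC. Qed.

(** For the [A]-valued form [<b, c> = b^* c] on [A], the element [un_star x] acts as the adjoint of
    [x]. *)
Lemma un_act_star x b c :
  cmul (cstar b) (un_act x c) = cmul (cstar (un_act (un_star x) b)) c.
Proof.
rewrite /un_act /= cmulDr cstarD cmulDl cstarM cstarK cstarZc conjcK.
by rewrite cmulZl cmulZr cmulA.
Qed.

Definition opnorm x : R := sup [set rnorm (un_act x b) | b in [set b | rnorm b <= 1]].

Lemma opnorm_has_sup x :
  has_sup [set rnorm (un_act x b) | b in [set b | rnorm b <= 1]].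
Proof.
split; first by exists (rnorm (un_act x 0)), 0 => //=; rewrite rnorm0.
exists (cabs x.1 + rnorm x.2) => _ [b /= b1 <-].
apply: le_trans (rnormD _ _) _; rewrite rnormZ; apply: lerD.
  by rewrite ler_piMr // cabs_ge0.
by apply: le_trans (rnormM _ _) _; rewrite ler_piMr // rnorm_ge0.
Qed.

Lemma opnormP x b : rnorm (un_act x b) <= opnorm x * rnorm b.
Proof.
have [b0|b0] := eqVneq (rnorm b) 0.
  by rewrite (rnorm_eq0 b0) -(scale0r 0) un_actZ !scale0r rnorm0 mulr0.
have bp : 0 < rnorm b by rewrite lt_def b0 rnorm_ge0.
rewrite -ler_pdivrMr // mulrC -(rnormZr (un_act x b)) ?invr_ge0 ?rnorm_ge0 // -un_actZ.
apply: ub_le_sup; first by case: (opnorm_has_sup x).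
by eexists; last reflexivity; rewrite /= rnormZr ?invr_ge0 ?rnorm_ge0 // mulVf.
Qed.

Lemma opnorm_le x M : 0 <= M ->
  (forall b, rnorm (un_act x b) <= M * rnorm b) -> opnorm x <= M.
Proof.
move=> M0 H; apply: ge_sup; first by case: (opnorm_has_sup x).
by move=> _ [b /= b1 <-]; apply: le_trans (H b) _; rewrite ler_piMr.
Qed.

Lemma opnorm_ge0 x : 0 <= opnorm x.
Proof.
apply: le_trans (rnorm_ge0 (un_act x 0)) _; apply: ub_le_sup.
  by case: (opnorm_has_sup x).
by exists 0 => //=; rewrite rnorm0.
Qed.

(** For [c = x^* b] the adjoint relation gives [|c|^2 = |b^* (x c)| <= |b| |x| |c|]. *)
Lemma opnorm_star_le x : opnorm (un_star x) <= opnorm x.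
Proof.
apply: opnorm_le (opnorm_ge0 x) _ => b; set c := un_act _ b.
have [->|c0] := eqVneq (rnorm c) 0.
  by rewrite mulr_ge0 ?opnorm_ge0 ?rnorm_ge0.
have cp : 0 < rnorm c by rewrite lt_def c0 rnorm_ge0.
rewrite -(ler_pM2r cp) -expr2 -rnorm_cstarM -un_act_star.
apply: le_trans (rnormM _ _) _; rewrite rnorm_cstar mulrC mulrAC.
by rewrite ler_wpM2r ?rnorm_ge0 ?opnormP.
Qed.

Lemma opnormM x y : opnorm (x * y) <= opnorm x * opnorm y.
Proof.
apply: opnorm_le => [|b]; first by rewrite mulr_ge0 ?opnorm_ge0.
rewrite un_actM; apply: le_trans (opnormP _ _) _.
by rewrite -mulrA ler_wpM2l ?opnorm_ge0 ?opnormP.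
Qed.

Lemma opnormD x y : opnorm (x + y) <= opnorm x + opnorm y.
Proof.
apply: opnorm_le => [|b]; first by rewrite addr_ge0 ?opnorm_ge0.
by rewrite un_actD; apply: le_trans (rnormD _ _) _; rewrite mulrDl lerD ?opnormP.
Qed.

(** The substantial half of the C*-identity, from [|x b|^2 = |b^* (x^* x b)| <= |x^* x| |b|^2]. *)
Lemma opnorm_star_sqr x : opnorm x ^+ 2 <= opnorm (un_star x * x).
Proof.
set M := opnorm (_ * _).
suff : opnorm x <= Num.sqrt M.
  move=> H; rewrite -[leRHS]sqr_sqrtr ?opnorm_ge0 //.
  by rewrite lerXn2r ?nnegrE ?opnorm_ge0 ?sqrtr_ge0.
apply: opnorm_le => [|b]; first exact: sqrtr_ge0.
rewrite -(@ler_pXn2r _ 2) ?nnegrE ?mulr_ge0 ?sqrtr_ge0 ?rnorm_ge0 //.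
rewrite exprMn sqr_sqrtr ?opnorm_ge0 // -rnorm_cstarM.
rewrite -[X in un_act X b](_ : un_star (un_star x) = x); last first.
  by apply: un_eq; rewrite /= ?conjcK ?cstarK.
rewrite -un_act_star -un_actM (_ : un_star (un_star x) = x); last first.
  by apply: un_eq; rewrite /= ?conjcK ?cstarK.
apply: le_trans (rnormM _ _) _; rewrite rnorm_cstar expr2 mulrCA.
by rewrite ler_wpM2l ?rnorm_ge0 ?opnormP.
Qed.

(** Let [x] act on the adjoint of [x.2]: up to the scalar term this is [x.2] times its adjoint, of
    norm [|x.2|^2]. Definiteness and completeness of the unitization, and isometry of the embedding
    of [A], rest on this bound. *)
Lemma rnorm_le_opnorm x : rnorm x.2 <= opnorm x + cabs x.1.
Proof.
have [->|a0] := eqVneq (rnorm x.2) 0.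
  by rewrite addr_ge0 ?opnorm_ge0 ?cabs_ge0.
have ap : 0 < rnorm x.2 by rewrite lt_def a0 rnorm_ge0.
have E : cmul x.2 (cstar x.2) = un_act x (cstar x.2) - x.1 *: cstar x.2.
  by rewrite /un_act addrAC subrr add0r.
have := rnorm_cstarM (cstar x.2); rewrite cstarK rnorm_cstar E => H.
rewrite -(ler_pM2r ap) -expr2 -H mulrDl; apply: le_trans (rnormD _ _) _.
rewrite rnormN rnormZ rnorm_cstar; apply: lerD => //.
by have := opnormP x (cstar x.2); rewrite rnorm_cstar.
Qed.

(** If [A] has a unit [e], then [(1, -e)] acts as zero, so the operator norm alone may fail to be
    definite. The maximum with the modulus of the character [x.1] is definite and still satisfies
    the C*-identity. *)
Definition un_norm x : R := Num.max (cabs x.1) (opnorm x).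

Lemma un_norm_lub x M : cabs x.1 <= M -> opnorm x <= M -> un_norm x <= M.
Proof. by rewrite /un_norm ge_max => -> ->. Qed.

Lemma cabs_le_un_norm x : cabs x.1 <= un_norm x.
Proof. by rewrite /un_norm le_max lexx. Qed.

Lemma opnorm_le_un_norm x : opnorm x <= un_norm x.
Proof. by rewrite /un_norm le_max lexx orbT. Qed.

Lemma un_norm_ge0 x : 0 <= un_norm x.
Proof. by apply: le_trans (cabs_le_un_norm x); apply: cabs_ge0. Qed.

Lemma un_normD x y : un_norm (x + y) <= un_norm x + un_norm y.
Proof.
apply: un_norm_lub.
  apply: le_trans (cabsD _ _) _; exact: lerD (cabs_le_un_norm x) (cabs_le_un_norm y).
apply: le_trans (opnormD _ _) _.
exact: lerD (opnorm_le_un_norm x) (opnorm_le_un_norm y).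
Qed.

Lemma un_normM x y : un_norm (x * y) <= un_norm x * un_norm y.
Proof.
apply: un_norm_lub.
  by rewrite /= cabsM ler_pM ?cabs_ge0 ?cabs_le_un_norm.
by apply: le_trans (opnormM _ _) _; rewrite ler_pM ?opnorm_ge0 ?opnorm_le_un_norm.
Qed.

Lemma un_norm_st x : un_norm (un_star x) <= un_norm x.
Proof.
apply: un_norm_lub; first by rewrite /= cabs_conj cabs_le_un_norm.
exact: le_trans (opnorm_star_le x) (opnorm_le_un_norm x).
Qed.

Lemma un_norm_star x : un_norm (un_star x * x) = un_norm x ^+ 2.
Proof.
apply/le_anti/andP; split.
  apply: le_trans (un_normM _ _) _.
  by rewrite expr2 ler_wpM2r ?un_norm_ge0 ?un_norm_st.
rewrite {1}/un_norm; case: (leP (cabs x.1) (opnorm x)) => _.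
  exact: le_trans (opnorm_star_sqr x) (opnorm_le_un_norm _).
by apply: le_trans (cabs_le_un_norm _); rewrite /= cabsM cabs_conj expr2.
Qed.

Lemma rnorm_le_un_norm x : rnorm x.2 <= un_norm x + un_norm x.
Proof.
apply: le_trans (rnorm_le_opnorm x) _.
exact: lerD (opnorm_le_un_norm x) (cabs_le_un_norm x).
Qed.

Lemma un_norm_le x : un_norm x <= cabs x.1 + rnorm x.2.
Proof.
apply: un_norm_lub; first by rewrite lerDl rnorm_ge0.
apply: opnorm_le => [|b]; first by rewrite addr_ge0 ?cabs_ge0 ?rnorm_ge0.
by apply: le_trans (rnormD _ _) _; rewrite rnormZ mulrDl lerD ?rnormM.
Qed.

Lemma un_norm_eq0 x : un_norm x = 0 -> x = 0.
Proof.
move=> x0; apply: un_eq => /=.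
  apply: cabs_eq0; apply/le_anti; rewrite cabs_ge0 andbT -x0.
  exact: cabs_le_un_norm.
apply: rnorm_eq0; apply/le_anti; rewrite rnorm_ge0 andbT.
by have := rnorm_le_un_norm x; rewrite x0 addr0.
Qed.

Lemma un_norm_inj a : un_norm (un_inj a) = rnorm a.
Proof.
apply/le_anti/andP; split.
  by have := un_norm_le (un_inj a); rewrite /= [cabs 0](_ : _ = 0) ?add0r // /cabs normr0.
have := rnorm_le_opnorm (un_inj a); rewrite /= [cabs 0](_ : _ = 0) ?addr0 /cabs ?normr0 //.
by move=> /le_trans; apply; apply: opnorm_le_un_norm.
Qed.

Definition un_sc (r : R) : U := (r%:C, 0).

Lemma un_sc_additive : additive un_sc.
Proof. by move=> r s; apply: un_eq => /=; rewrite ?rmorphB ?subr0. Qed.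

Lemma un_sc_multiplicative : multiplicative un_sc.
Proof.
split=> [r s|//]; apply: un_eq => /=; first by rewrite rmorphM.
by rewrite !scaler0 cmul0 !addr0.
Qed.

HB.instance Definition _ := GRing.isAdditive.Build R U un_sc un_sc_additive.
HB.instance Definition _ := GRing.isMultiplicative.Build R U un_sc un_sc_multiplicative.

Lemma un_norm_complete (u : nat -> U) (C r : R) : 0 <= r < 1 ->
  (forall n, un_norm (u n.+1 - u n) <= C * r ^+ n) ->
  exists l : U, forall e : R, 0 < e ->
    exists n, un_norm (u n.+1 - l) <= e /\ un_norm (u n - l) <= e.
Proof.
move=> r01 H.
have N0 : un_norm 0 = 0.
  apply/le_anti; rewrite un_norm_ge0 andbT.
  by have := un_norm_le 0; rewrite /= /cabs normr0 rnorm0 addr0.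
have Cu := geometric_cauchy N0 un_normD r01 H.
have [|l Hl] := @cabs_complete R (fun n => (u n).1).
  move=> e /Cu[n Hn]; exists n => k /Hn; apply: le_trans.
  exact: (cabs_le_un_norm (u k - u n)).
have [|a Ha] := @rnorm_complete R A (fun n => (u n).2).
  move=> e e0; have /Cu[n Hn] : 0 < e / 2 by lra.
  exists n => k /Hn; have := rnorm_le_un_norm (u k - u n) => /=; lra.
exists (l, a) => e e0; have e2 : 0 < e / 2 by lra.
have [n Hn] := Hl _ e2; have [m Hm] := Ha _ e2.
have W k : (maxn n m <= k)%N -> un_norm (u k - (l, a)) <= e.
  rewrite geq_max => /andP[/Hn h1 /Hm h2].
  by have := un_norm_le (u k - (l, a)) => /=; lra.
by exists (maxn n m); split; apply: W => //; apply: leqW.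
Qed.

(** Left transparent: later steps identify its norm and involution with [un_norm] and [un_star] by
    conversion. *)
Definition unitization_cstar : unital_cstar R U.
Proof.
refine (@UnitalCStar R U un_star un_norm un_sc (('i, 0) : U) _ _ _ _ _ _ _ _
  un_norm_ge0 un_normD un_normM _ un_norm_star un_norm_eq0 un_norm_complete).
- by move=> x; apply: un_eq; rewrite /= ?conjcK ?cstarK.
- by move=> x y; apply: un_eq; rewrite /= ?rmorphD ?cstarD.
- move=> x y; apply: un_eq; rewrite /= ?rmorphM 1?mulrC //.
  by rewrite !cstarD !cstarZc cstarM; abel.
- by move=> r; apply: un_eq; rewrite /= ?oppr0 // cstar0.
- apply: un_eq => /=; last by rewrite cstar0 oppr0.
  by apply/eqP; rewrite eq_complex /= oppr0 !eqxx.
- move=> r x; apply: un_eq; rewrite /= 1?mulrC //.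
  by rewrite scaler0 cmul0 cmul0l add0r !addr0.
- move=> x; apply: un_eq; rewrite /= 1?mulrC //.
  by rewrite scaler0 cmul0 cmul0l add0r !addr0.
- apply: un_eq; rewrite /= ?scaler0 ?cmul0 ?addr0 ?oppr0 //.
  by rewrite -expr2 sqr_i.
- move=> r; apply/le_anti/andP; split.
    by have := un_norm_le (un_sc r); rewrite /= cabs_real rnorm0 addr0.
  by have := cabs_le_un_norm (un_sc r); rewrite /= cabs_real.
Defined.

End unitization.

(** * The column norm of a Hilbert module *)

Section cstar_positivity.
Context (R : realType) (A : cstarAlgType R).
Implicit Types (a b p q : A).

Definition apos a := upos (unitization_cstar A) (un_inj a).

Lemma un_injD a b : un_inj (a + b) = un_inj a + un_inj b.
Proof. by apply: un_eq; rewrite /= ?addr0. Qed.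

Lemma un_injN a : un_inj (- a) = - un_inj a.
Proof. by apply: un_eq; rewrite /= ?oppr0. Qed.

Lemma un_injM a b : un_inj (cmul a b) = un_inj a * un_inj b.
Proof. by apply: un_eq; rewrite /= ?mul0r // !scale0r !add0r. Qed.

Lemma un_inj_star a : un_inj (cstar a) = un_star (un_inj a).
Proof.
by apply: un_eq => //=; apply/eqP; rewrite eq_complex /= oppr0 !eqxx.
Qed.

Lemma un_injZ (r : R) a : un_inj (r%:C *: a) = un_sc A r * un_inj a.
Proof.
by apply: un_eq; rewrite /= ?mulr0 // scale0r cmul0l !addr0.
Qed.

Lemma apos_cpos a : cpos a -> apos a.
Proof.
move=> [b ->]; rewrite /apos un_injM un_inj_star.
exact: (upos_star (unitization_cstar A)).
Qed.

Lemma aposD a b : apos a -> apos b -> apos (a + b).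
Proof. by rewrite /apos un_injD; apply: uposD. Qed.

Lemma aposZ (r : R) a : 0 <= r -> apos a -> apos (r%:C *: a).
Proof. by move=> r0 pa; rewrite /apos un_injZ; apply: (uposZ r0 pa). Qed.

Lemma rnorm_le_aposD p q : apos p -> apos q -> rnorm p <= rnorm (p + q).
Proof.
move=> pp pq; rewrite -!un_norm_inj un_injD.
exact: (upos_unm_leD pp pq).
Qed.

Lemma apos_star a : apos (cmul (cstar a) a).
Proof. by apply: apos_cpos; exists a. Qed.

End cstar_positivity.

(** * Cauchy-Schwarz, the column norm, and its quadratic vector fields *)

Section hilbert_module.
Context (R : realType) (A : cstarAlgType R) (E : hilbertModType A).
Implicit Types (x y : E) (z w : (E * E)%type) (a : A).

Lemma innerNr x y : inner x (- y) = - inner x y.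
Proof. by rewrite -scaleN1r innerZr scaleN1r. Qed.

Lemma innerNl x y : inner (- x) y = - inner x y.
Proof. by rewrite -inner_star innerNr cstarN inner_star. Qed.

Lemma inner0r x : inner x 0 = 0.
Proof. by rewrite -(scale0r 0) innerZr !scale0r. Qed.

Lemma innerZlc (l : R[i]) x y : inner (l *: x) y = conjc l *: inner x y.
Proof. exact: innerZl. Qed.

Lemma apos_inner x : apos (inner x x).
Proof. exact/apos_cpos/inner_pos. Qed.

Lemma rnorm_inner x : rnorm (inner x x) = rnorm x ^+ 2.
Proof. by apply: complexI; rewrite -rnormE -norm_inner rnormE rmorphXn. Qed.

Lemma rnorm_ract x a : rnorm (ract x a) <= rnorm x * rnorm a.
Proof.
rewrite -(@ler_pXn2r _ 2) ?nnegrE ?mulr_ge0 ?rnorm_ge0 //.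
rewrite -rnorm_inner innerMr innerMl; apply: le_trans (rnormM _ _) _.
rewrite exprMn -rnorm_inner expr2 mulrA ler_wpM2r ?rnorm_ge0 //.
by apply: le_trans (rnormM _ _) _; rewrite rnorm_cstar mulrC.
Qed.

(** With [v = y - x d], one has [<y,y> = d^* d + <v,v> + d^* (1 - q) d]. Since [|q| < 1], the factor
    [1 - q] has a square root, so the last term is [K^* K] and [d^* d] is dominated by [<y,y>]. *)
Lemma inner_contract x y : rnorm x < 1 -> rnorm (inner x y) <= rnorm y.
Proof.
move=> x1; set q := inner x x; set d := inner x y; pose W := unitization_cstar A.
have Nq : unm W (un_inj q) < 1.
  by rewrite [unm _ _]un_norm_inj rnorm_inner expr_lt1 ?rnorm_ge0.
have sQ : ust W (un_inj q) = un_inj q by rewrite -[LHS]un_inj_star inner_star.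
have [m [sm mE _]] := usqrt1B sQ Nq.
pose v := y - ract x d; pose K : unitization A := (1 - m) * un_inj d.
have KK : ust W K * K = un_star (un_inj d) * (1 - un_inj q) * un_inj d.
  by rewrite /K ustM ustD ustN ust1 sm -mE !mulrA.
have vE : inner v v = inner y y - cmul (cstar d) d - cmul (cstar d) d
    + cmul (cmul (cstar d) q) d.
  rewrite /v !(innerDl, innerDr, innerNl, innerNr, innerMl, innerMr).
  by rewrite -/d -/q -[inner y x]inner_star -/d !(cmulDr, cmulNr) cmulA; abel.
have := upos_unm_leD (apos_star d) (uposD (apos_inner v) (upos_star W K)).
have -> : un_inj (cmul (cstar d) d) + (un_inj (inner v v) + ust W K * K) =
    un_inj (inner y y).
  rewrite vE KK !(un_injD, un_injN, un_injM, un_inj_star).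
  by rewrite !(mulrBl, mulrBr, mul1r, mulr1); abel.
rewrite ![unm _ _]un_norm_inj rnorm_cstarM rnorm_inner.
by rewrite ler_pXn2r ?nnegrE ?rnorm_ge0.
Qed.

Lemma inner_cauchy_schwarz x y : rnorm (inner x y) <= rnorm x * rnorm y.
Proof.
apply: (le_epsC (rnorm_ge0 y)) => e e0.
have d0 : 0 < rnorm x + e by have := rnorm_ge0 x; lra.
have := @inner_contract ((rnorm x + e)^-1%:C *: x) y.
rewrite rnormZr ?invr_ge0 ?(ltW d0) // mulrC ltr_pdivrMr // mul1r ltrDl => /(_ e0).
rewrite innerZlc conjc_real rnormZr ?invr_ge0 ?(ltW d0) // mulrC ler_pdivrMr //.
by rewrite mulrDr mulrC.
Qed.

Definition colip z w : A := inner z.1 w.1 + inner z.2 w.2.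
Definition colnm z : R := Num.sqrt (rnorm (colip z z)).

Lemma apos_colip z : apos (colip z z).
Proof. by apply: aposD; apply: apos_inner. Qed.

Lemma colnm_ge0 z : 0 <= colnm z.
Proof. exact: sqrtr_ge0. Qed.

Lemma colnm_sqr z : colnm z ^+ 2 = rnorm (colip z z).
Proof. by rewrite sqr_sqrtr ?rnorm_ge0. Qed.

Lemma colipZ (l m : R[i]) z w : colip (l *: z) (m *: w) = (conjc l * m) *: colip z w.
Proof.
by rewrite /colip /= !innerZlc !innerZr !scalerA -scalerDr.
Qed.

Lemma colipDl z z' w : colip (z + z') w = colip z w + colip z' w.
Proof. by rewrite /colip /= !innerDl; abel. Qed.

Lemma colipDr z w w' : colip z (w + w') = colip z w + colip z w'.
Proof. by rewrite /colip /= !innerDr; abel. Qed.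

Lemma colipNr z w : colip z (- w) = - colip z w.
Proof. by rewrite /colip /= !innerNr opprD. Qed.

Lemma colipNl z w : colip (- z) w = - colip z w.
Proof. by rewrite /colip /= !innerNl opprD. Qed.

Lemma colnmZ (l : R[i]) z : colnm (l *: z) = cabs l * colnm z.
Proof.
rewrite /colnm colipZ rnormZ cabsM cabs_conj sqrtrM ?mulr_ge0 ?cabs_ge0 //.
by rewrite -expr2 sqrtr_sqr ger0_norm ?cabs_ge0.
Qed.

Lemma colnm_fst z : rnorm z.1 <= colnm z.
Proof.
rewrite -(@ler_pXn2r _ 2) ?nnegrE ?rnorm_ge0 ?colnm_ge0 // colnm_sqr -rnorm_inner.
by apply: rnorm_le_aposD; apply: apos_inner.
Qed.

Lemma colnm_snd z : rnorm z.2 <= colnm z.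
Proof.
rewrite -(@ler_pXn2r _ 2) ?nnegrE ?rnorm_ge0 ?colnm_ge0 // colnm_sqr -rnorm_inner.
by rewrite /colip addrC; apply: rnorm_le_aposD; apply: apos_inner.
Qed.

Lemma colnm_eq0 z : colnm z = 0 -> z = 0.
Proof.
move=> z0; have [z10 z20] : z.1 = 0 /\ z.2 = 0.
  by split; apply: rnorm_eq0; apply/le_anti; rewrite rnorm_ge0 andbT -z0
    ?colnm_fst ?colnm_snd.
by rewrite (surjective_pairing z) z10 z20.
Qed.

(* With [p = |z|] and [q = |w|], compare [pq <z+w,z+w>] with
   [pq <z+w,z+w> + <qz-pw,qz-pw> = (pq+q^2) <z,z> + (pq+p^2) <w,w>]. *)
Lemma colnmD z w : colnm (z + w) <= colnm z + colnm w.
Proof.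
have [z0|z0] := eqVneq (colnm z) 0.
  by rewrite z0 (colnm_eq0 z0) !add0r.
have [w0|w0] := eqVneq (colnm w) 0.
  by rewrite w0 (colnm_eq0 w0) !addr0.
set p := colnm z; set q := colnm w.
have pp : 0 < p by rewrite lt_def z0 colnm_ge0.
have qp : 0 < q by rewrite lt_def w0 colnm_ge0.
rewrite -(@ler_pXn2r _ 2) ?nnegrE ?addr_ge0 ?colnm_ge0 //.
rewrite -(ler_pM2l (mulr_gt0 pp qp)) colnm_sqr.
pose v := q%:C *: z - p%:C *: w.
have vE : (p * q)%:C *: colip (z + w) (z + w) + colip v v =
   (p * q + q ^+ 2)%:C *: colip z z + (p * q + p ^+ 2)%:C *: colip w w.
  rewrite /v !(colipDl, colipDr, colipNl, colipNr) !colipZ !conjc_real -!rmorphM /=.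
  rewrite !expr2 !(mulrC q p) !rmorphD !scalerDl !scalerDr; abel.
have : rnorm ((p * q)%:C *: colip (z + w) (z + w)) <=
    rnorm ((p * q + q ^+ 2)%:C *: colip z z + (p * q + p ^+ 2)%:C *: colip w w).
  rewrite -vE; apply: rnorm_le_aposD; last exact: apos_colip.
  by apply: aposZ (apos_colip _); rewrite mulr_ge0 // ltW.
rewrite rnormZr ?mulr_ge0 ?(ltW pp) ?(ltW qp) // => /le_trans; apply.
apply: le_trans (rnormD _ _) _.
rewrite !rnormZr -?colnm_sqr ?addr_ge0 ?mulr_ge0 ?sqr_ge0 ?(ltW pp) ?(ltW qp) //.
by rewrite -/p -/q; lra.
Qed.

(* Infinitesimal form of the Moebius maps of the unit ball: the identity
   [<w,w> + (1-c)^*(1-<z,z>)(1-c) + (c+c^* )^2 = 1 + <a,a> + 2c^*c + cc^*]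
   holds in the unitization, with [c = <a,z.2>]. *)
Lemma colnm_transvection z (a : E) : colnm z < 1 ->
  colnm (z.1 - ract z.1 (inner a z.2), z.2 + a - ract z.2 (inner a z.2)) ^+ 2
    <= 1 + 4 * rnorm a ^+ 2.
Proof.
move=> z1; set c := inner a z.2; set w := (_, _); rewrite colnm_sqr.
pose q := colip z z.
have wE : colip w w = q + c + cstar c - cmul q c - cmul (cstar c) q
   + inner a a - cmul c c - cmul (cstar c) (cstar c) + cmul (cmul (cstar c) q) c.
  rewrite /colip /= !(innerDl, innerDr, innerNl, innerNr, innerMl, innerMr).
  rewrite -/c -[inner z.2 a]inner_star -/c /q /colip.
  by rewrite !(cmulDl, cmulDr, cmulNl, cmulNr) !cmulA; abel.
pose W := unitization_cstar A.
have sq : cstar q = q by rewrite /q /colip cstarD !inner_star.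
have Nq : unm W (un_inj q) < 1.
  by rewrite [unm _ _]un_norm_inj -colnm_sqr expr_lt1 ?colnm_ge0.
clearbody q.
have sQ : ust W (un_inj q) = un_inj q by rewrite -[LHS]un_inj_star sq.
have [m [sm mE _]] := usqrt1B sQ Nq.
set Q := un_inj q in sQ mE; set C := un_inj c; set C' := un_star C.
pose K : unitization A := (1 - m) * (1 - C).
have KK : ust W K * K = (1 - C') * (1 - Q) * (1 - C).
  rewrite /K ustM !ustD !ustN !ust1 sm -[ust W C]/C' -mE.
  by rewrite !mulrA.
have pos : upos W (ust W K * K + (C + C') * (C + C')).
  apply: uposD; first exact: upos_star.
  by apply: upos_sqr; rewrite ustD [ust W C']ustK addrC.
have IE : un_inj (colip w w) + (ust W K * K + (C + C') * (C + C')) =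
    1 + un_inj (inner a a) + (C' * C + C' * C + C * C').
  rewrite wE KK !(un_injD, un_injN, un_injM, un_inj_star) -/C -/C' -/Q.
  by rewrite !(mulrBl, mulrBr, mul1r, mulr1, mulrDl, mulrDr); abel.
(* Since [|z.2| <= |z| < 1], each of the three products in the remainder of the identity has norm at
   most [|a|^2]; with [<a,a>] this makes the constant [4]. *)
have c1 : rnorm c <= rnorm a.
  apply: le_trans (inner_cauchy_schwarz _ _) _; rewrite ler_piMr ?rnorm_ge0 //.
  by apply/ltW/le_lt_trans/z1/colnm_snd.
have NC : unm W C <= rnorm a by rewrite [unm _ _]un_norm_inj.
have NC' : unm W C' <= rnorm a by rewrite [unm _ _](unm_st W).
have NN (X Y : unitization A) : unm W X <= rnorm a -> unm W Y <= rnorm a ->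
    unm W (X * Y) <= rnorm a ^+ 2.
  by move=> HX HY; apply: le_trans (unmM W _ _) _; rewrite expr2 ler_pM ?unm_ge0.
have := upos_unm_leD (apos_colip w) pos; rewrite IE [unm _ _]un_norm_inj => /le_trans; apply.
have h1 := unmD W (1 + un_inj (inner a a)) (C' * C + C' * C + C * C').
have h2 := unmD W 1 (un_inj (inner a a)).
rewrite unm1 [unm W (un_inj _)]un_norm_inj rnorm_inner in h2.
have h3 := unmD W (C' * C + C' * C) (C * C').
have h4 := unmD W (C' * C) (C' * C).
have := NN _ _ NC NC'; have := NN _ _ NC' NC; lra.
Qed.

End hilbert_module.

(** * Columns as matrices with a zero second column *)

Section column_matrix.
Context (R : realType) (A : cstarAlgType R) (E : hilbertModType A).

Definition colmx2 (z : (E * E)%type) : 'M[E]_2 :=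
  \matrix_(i, j) (if j == ord0 then if i == ord0 then z.1 else z.2 else 0).

(** Such a matrix sees only the first entry of a vector, and the supremum is attained when that
    entry is [g^* / |g|], because [|g g^*| = |g|^2]. *)
Lemma mxcnorm_corner (g : A) (G : 'M[A]_2) :
  (forall i j, G i j = if (i == ord0) && (j == ord0) then g else 0) ->
  mxcnorm G = rnorm g.
Proof.
move=> GE.
have cE v : colnorm (cmulmx G v) = rnorm (cmul g (v ord0 ord0)).
  rewrite /colnorm !big_ord_recl big_ord0 !mxE !big_ord_recl !big_ord0 !GE /=.
  rewrite !cmul0l !addr0 cmul0 addr0 rnorm_cstarM sqrtr_sqr ger0_norm ?rnorm_ge0 //.
have ub : ubound [set colnorm (cmulmx G v) | v in [set v : 'cV[A]_2 | colnorm v <= 1]] (rnorm g).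
  move=> _ [v /= v1 <-]; rewrite cE; apply: le_trans (rnormM _ _) _.
  rewrite ler_piMr ?rnorm_ge0 //.
  rewrite -(@ler_pXn2r _ 2) ?nnegrE ?rnorm_ge0 // expr1n -rnorm_cstarM.
  have : colnorm v ^+ 2 <= 1 by rewrite exprn_ile1 ?sqrtr_ge0.
  rewrite sqr_sqrtr ?rnorm_ge0 // !big_ord_recl big_ord0 addr0; apply: le_trans.
  by apply: rnorm_le_aposD; apply: apos_star.
have colE (b : A) : colnorm (\matrix_(i, j) (if i == ord0 then b else 0) : 'cV[A]_2) = rnorm b.
  rewrite /colnorm !big_ord_recl big_ord0 !mxE /= cmul0 !addr0.
  by rewrite rnorm_cstarM sqrtr_sqr ger0_norm ?rnorm_ge0.
apply/le_anti/andP; split.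
  apply: ge_sup => //; exists (colnorm (cmulmx G (\matrix_(i, j) (if i == ord0 then 0 else 0)))).
  by eexists; last reflexivity; rewrite /= colE rnorm0.
have [->|g0] := eqVneq (rnorm g) 0.
  apply: le_trans (_ : colnorm (cmulmx G (\matrix_(i, j) (if i == ord0 then 0 else 0))) <= _).
    exact: sqrtr_ge0.
  apply: ub_le_sup; first by exists (rnorm g).
  by eexists; last reflexivity; rewrite /= colE rnorm0.
have gp : 0 < rnorm g by rewrite lt_def g0 rnorm_ge0.
pose b := (rnorm g)^-1%:C *: cstar g.
have gb : rnorm (cmul g b) = rnorm g.
  rewrite /b cmulZr rnormZr ?invr_ge0 ?rnorm_ge0 //.
  have := rnorm_cstarM (cstar g); rewrite cstarK rnorm_cstar => ->.
  by rewrite expr2 mulKf.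
rewrite -[leLHS]gb; apply: ub_le_sup; first by exists (rnorm g).
exists (\matrix_(i, j) (if i == ord0 then b else 0)); last by rewrite cE mxE.
by rewrite /= colE /b rnormZr ?invr_ge0 ?rnorm_ge0 // rnorm_cstar mulVf.
Qed.

Lemma mxhnorm_colmx2 z : mxhnorm (colmx2 z) = colnm z.
Proof.
rewrite /mxhnorm /colnm; congr Num.sqrt; apply: mxcnorm_corner => i j.
rewrite mxE !big_ord_recl big_ord0 !mxE /= addr0.
case: (i == ord0); case: (j == ord0) => //=; rewrite ?inner0r ?addr0 //.
  by rewrite -!(inner_star _ 0) !inner0r cstar0 addr0.
Qed.

End column_matrix.

Lemma colnm_2isometry (R : realType) (A B : cstarAlgType R) (E : hilbertModType A)
    (F : hilbertModType B) (T : {linear E -> F}) :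
  n_isometry 2 T -> forall z, colnm (T z.1, T z.2) = colnm z.
Proof.
move=> T2 z; rewrite -!mxhnorm_colmx2 -[RHS]T2; congr mxhnorm.
by apply/matrixP => i j; rewrite !mxE; case: ifP => _; [case: ifP | rewrite linear0].
Qed.

(** * Cartan's uniqueness argument *)

Section roots_of_unity.
Context (R : realType).

(** Iterated square roots of [-1] replace the exponential. If [zeta ^+ i = 1], the gcd of [i] and
    [2 ^ j.+1] is a power of two killing [zeta]; were it at most [2 ^ j], then [zeta ^+ (2 ^ j)]
    would be [1] instead of [-1]. *)
Lemma root_of_unity_pow2 (j : nat) :
  exists zeta : R[i], [/\ cabs zeta = 1, zeta ^+ (2 ^ j.+1) = 1 &
    forall i, (0 < i < 2 ^ j.+1)%N -> zeta ^+ i != 1].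
Proof.
have [zeta zE] : exists zeta : R[i], zeta ^+ (2 ^ j) = -1.
  elim: j => [|j [z zE]]; first by exists (-1); rewrite expn0 expr1.
  by exists (sqrtc z); rewrite expnS exprM sqr_sqrtc.
have z1 : zeta ^+ (2 ^ j.+1) = 1 by rewrite expnSr exprM zE sqrrN expr1n.
have c1 : cabs zeta = 1.
  apply/eqP; rewrite -(@pexpr_eq1 _ _ (2 ^ j.+1)) ?cabs_ge0 ?expn_gt0 //.
  by rewrite -cabsX z1 /cabs normr1.
exists zeta; split=> // i /andP[i0 ij]; apply/eqP => zi.
have : (2 ^ j.+1 %| i)%N.
  pose g := gcdn i (2 ^ j.+1).
  have zg : zeta ^+ g = 1.
    have [u v uv _] := egcdnP (2 ^ j.+1) i0.
    have : zeta ^+ (u * i) = 1 by rewrite mulnC exprM zi expr1n.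
    by rewrite uv exprD mulnC exprM z1 expr1n mul1r.
  have /(dvdn_pfactor _ _ (isT : prime 2))[k kj gE] : (g %| 2 ^ j.+1)%N by exact: dvdn_gcdr.
  have [kj'|kj'] := ltnP k j.+1.
    have : zeta ^+ (2 ^ j) = 1.
      by rewrite -(subnK (kj' : (k <= j)%N)) addnC expnD exprM -gE zg expr1n.
    rewrite zE => /eqP; rewrite eq_sym -subr_eq0 opprK -[1 + 1]/(2%:R) pnatr_eq0.
    by [].
  have -> : (2 ^ j.+1 = g)%N by rewrite gE; congr (2 ^ _)%N; apply/anti_leq; rewrite kj kj'.
  exact: dvdn_gcdl.
by move=> /dvdn_leq -/(_ i0); rewrite leqNgt ij.
Qed.

Lemma sum_root_of_unity (zeta : R[i]) n i :
  zeta ^+ n = 1 -> zeta ^+ i != 1 -> \sum_(k < n) (zeta ^+ k) ^+ i = 0.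
Proof.
move=> zn zi; have : (zeta ^+ i - 1) * (\sum_(k < n) (zeta ^+ i) ^+ k) = 0.
  by rewrite -subrX1 -exprM mulnC exprM zn expr1n subrr.
move=> /eqP; rewrite mulf_eq0 subr_eq0 (negPf zi) /= => /eqP S0.
by rewrite -[RHS]S0; apply: eq_bigr => k _; rewrite -!exprM mulnC.
Qed.

End roots_of_unity.

(** * Vector-valued polynomials and the discrete Cauchy estimate *)

Section vector_polynomials.
Context (R : realType) (V : lmodType R[i]).

(** Coefficients and degrees are left implicit: the remainder terms of an iterated quadratic map
    only have to be polynomial, never computed. *)
Inductive vpoly : (R[i] -> V) -> Prop :=
| vpolyC v : vpoly (fun=> v)
| vpolyD f g : vpoly f -> vpoly g -> vpoly (fun l => f l + g l)
| vpolyX f : vpoly f -> vpoly (fun l => l *: f l).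

Lemma vpoly_bilinear (H : V -> V -> V) :
  (forall x y z, H (x + y) z = H x z + H y z) ->
  (forall x y z, H x (y + z) = H x y + H x z) ->
  (forall l x y, H (l *: x) y = l *: H x y) ->
  (forall l x y, H x (l *: y) = l *: H x y) ->
  forall f g, vpoly f -> vpoly g -> vpoly (fun l => H (f l) (g l)).
Proof.
move=> HDl HDr HZl HZr f g pf pg; elim: pf => [v|f1 f2 _ p1 _ p2|f1 _ p1].
- elim: pg => [w|g1 g2 _ p1 _ p2|g1 _ p1]; first exact: vpolyC.
    rewrite (_ : (fun l => _) = (fun l => H v (g1 l) + H v (g2 l))); last exact/funext.
    exact: vpolyD.
  rewrite (_ : (fun l => _) = (fun l => l *: H v (g1 l))); last exact/funext.
  exact: vpolyX.
- rewrite (_ : (fun l => _) = (fun l => H (f1 l) (g l) + H (f2 l) (g l))); last exact/funext.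
  exact: vpolyD.
- rewrite (_ : (fun l => _) = (fun l => l *: H (f1 l) (g l))); last exact/funext.
  exact: vpolyX.
Qed.

(** [D] bounds the degree of [f], so the exponents occurring lie strictly between [0] and [n], where
    the power sums of a primitive [n]-th root vanish. Requiring [0 < m] excludes the constant
    term. *)
Lemma vpoly_average f : vpoly f -> exists D : nat, forall (m n : nat) (zeta : R[i]),
  (0 < m)%N -> (m + D < n)%N -> zeta ^+ n = 1 ->
  (forall i, (0 < i < n)%N -> zeta ^+ i != 1) ->
  \sum_(k < n) (zeta ^+ k) ^+ m *: f (zeta ^+ k) = 0.
Proof.
elim=> [v|f1 f2 _ [D1 H1] _ [D2 H2]|f1 _ [D H]].
- exists 0%N => m n zeta m0; rewrite addn0 => mn zn zi.
  by rewrite -scaler_suml sum_root_of_unity ?scale0r // zi // m0.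
- exists (maxn D1 D2) => m n zeta m0 mn zn zi.
  rewrite (eq_bigr (fun k : 'I_n => (zeta ^+ k) ^+ m *: f1 (zeta ^+ k) +
     (zeta ^+ k) ^+ m *: f2 (zeta ^+ k))); last by move=> k _; rewrite scalerDr.
  rewrite big_split /= H1 ?H2 ?addr0 //; apply: leq_ltn_trans mn;
    by rewrite leq_add2l ?leq_maxl ?leq_maxr.
- exists D.+1 => m n zeta m0 mn zn zi.
  rewrite -[RHS](H m.+1 n zeta) // ?addSnnS //; apply: eq_bigr => k _.
  by rewrite scalerA -exprSr.
Qed.

Context (N : V -> R).
Hypothesis ND : forall x y, N (x + y) <= N x + N y.
Hypothesis NZ : forall (l : R[i]) x, N (l *: x) = cabs l * N x.

(** Cauchy's formula for the second coefficient: multiply by [l^(n-2) = l^(-2)] and average over the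
    [n]-th roots of unity. The term in [z] acquires the exponent [n - 1] and the remainder becomes
    [l f(l)]; both average to zero. *)
Lemma cauchy_estimate2 (z w : V) (f : R[i] -> V) (M : R) : vpoly f ->
  (forall l, cabs l = 1 -> N (l *: z + l ^+ 2 *: w + l ^+ 3 *: f l) <= M) ->
  N w <= M.
Proof.
move=> /vpoly_average[D HD] HM.
have N0 : N 0 = 0 by rewrite -(scale0r 0) NZ /cabs normr0 mul0r.
pose j := D.+2; pose n := (2 ^ j.+1)%N.
have Dn : (D.+2 < n)%N by apply: ltn_trans (ltn_expl _ _) => //; rewrite /j.
have [zeta [z1 zn zi]] := root_of_unity_pow2 R j; rewrite -/n in zn zi.
pose F l := l *: z + l ^+ 2 *: w + l ^+ 3 *: f l.
have S : \sum_(k < n) (zeta ^+ k) ^+ (n - 2) *: F (zeta ^+ k) = n%:R *: w.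
  rewrite (eq_bigr (fun k : 'I_n => (zeta ^+ k) ^+ (n - 1) *: z + w +
      (zeta ^+ k) ^+ 1 *: f (zeta ^+ k))); last first.
    move=> k _; have n2 : (2 <= n)%N by apply: leq_trans Dn.
    have kn : (zeta ^+ k) ^+ n = 1 by rewrite -exprM mulnC exprM zn expr1n.
    rewrite /F !scalerDr !scalerA -exprSr -!exprD.
    rewrite subnK // kn scale1r -subSn // subSS.
    rewrite (_ : (n - 2 + 3 = n + 1)%N); first by rewrite exprD kn mul1r.
    by rewrite -{2}(subnK n2) -addnA.
  rewrite !big_split /= HD //; last by rewrite add1n; apply: ltn_trans Dn.
  rewrite -scaler_suml sum_root_of_unity ?scale0r ?add0r ?addr0 //; last first.
    rewrite zi // subn_gt0 (leq_trans _ Dn) //= ltn_subrL //=.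
    by rewrite (leq_trans _ Dn).
  by rewrite sumr_const card_ord scaler_nat.
have n0 : 0 < n%:R :> R by rewrite ltr0n expn_gt0.
have NS (I : nat) (G : nat -> V) (c : R) : (forall k, N (G k) <= c) ->
    N (\sum_(k < I) G k) <= I%:R * c.
  move=> HG; elim: I => [|I IH]; first by rewrite big_ord0 N0 mul0r.
  rewrite big_ord_recr /= -natr1 mulrDl mul1r.
  by apply: le_trans (ND _ _) _; apply: lerD.
have := NS n (fun k => (zeta ^+ k) ^+ (n - 2) *: F (zeta ^+ k)) M.
have cn : cabs (n%:R : R[i]) = n%:R.
  by rewrite -(rmorph_nat (real_complex R)) cabs_real ger0_norm ?(ltW n0).
rewrite S NZ cn ler_pM2l //; apply => k.
have ck : cabs (zeta ^+ k) = 1 by rewrite cabsX z1 expr1n.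
by rewrite NZ cabsX ck expr1n mul1r; apply: HM.
Qed.

(* H. Cartan's uniqueness theorem for the polynomial self-map
   [z |-> z + s H(z,z)]: its [n]-th iterate has quadratic part [n s H(z,z)],
   which stays bounded although [n s] is arbitrarily large. *)
Lemma cartan_quadratic (H : V -> V -> V) (C : R) :
  (forall x y z, H (x + y) z = H x z + H y z) ->
  (forall x y z, H x (y + z) = H x y + H x z) ->
  (forall l x y, H (l *: x) y = l *: H x y) ->
  (forall l x y, H x (l *: y) = l *: H x y) ->
  (forall z, 0 <= N z) -> 0 <= C ->
  (forall z (s : R), N z < 1 -> N (z + s%:C *: H z z) <= 1 + C * s ^+ 2) ->
  forall z, N (H z z) = 0.
Proof.
move=> HDl HDr HZl HZr N_ge0 C0 HC.
(* Rescaling from radius [r] to radius [1] turns the error into [C r^3 s^2], and [r <= 2] gives the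
   factor [8]. *)
have HC2 z (s r : R) : 0 < r -> r <= 2 -> N z < r ->
    N (z + s%:C *: H z z) <= r + 8 * C * s ^+ 2.
  move=> r0 r2 zr; have rn0 : r != 0 by rewrite gt_eqF.
  pose y := r^-1%:C *: z.
  have zE : z = r%:C *: y by rewrite scalerA -rmorphM mulfV // rmorph1 scale1r.
  have y1 : N y < 1.
    by rewrite NZ cabs_real gtr0_norm ?invr_gt0 // mulrC ltr_pdivrMr // mul1r.
  have -> : z + s%:C *: H z z = r%:C *: (y + (s * r)%:C *: H y y).
    by rewrite zE HZl HZr scalerDr !scalerA -!rmorphM; congr (_ + _%:C *: _); ring.
  rewrite NZ cabs_real gtr0_norm //.
  have := HC y (s * r) y1; rewrite -(ler_pM2l r0) => /le_trans; apply.
  rewrite exprMn mulrDr mulr1 lerD2l.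
  have s0 : 0 <= C * s ^+ 2 by rewrite mulr_ge0 ?sqr_ge0.
  have r3 : r * r ^+ 2 <= 8.
    by rewrite -exprS (le_trans (lerXn2r 3 _ _ r2)) ?nnegrE ?(ltW r0) //; lra.
  have := ler_wpM2l s0 r3; lra.
suff small z t : N z < 1 -> 0 < t -> t * N (H z z) <= 2.
  move=> z; pose r := (N z + 1)^-1; have z0 := N_ge0 z.
  have r0 : 0 < r by rewrite invr_gt0; lra.
  have rz : N (r%:C *: z) < 1.
    rewrite NZ cabs_real gtr0_norm // mulrC ltr_pdivrMr; lra.
  have h0 := N_ge0 (H z z).
  apply/eqP; apply: contraT => hn0.
  have hp : 0 < N (H z z) by rewrite lt_def hn0.
  have hr : 0 < r * (r * N (H z z)) by rewrite !mulr_gt0.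
  (* With this [t] the bound [small] would read [3 <= 2]. *)
  have t0 : 0 < 3 / (r * (r * N (H z z))) by rewrite divr_gt0.
  have := small _ _ rz t0; rewrite HZl HZr !NZ cabs_real gtr0_norm //.
  rewrite divfK ?gt_eqF //; lra.
move=> z1 t0.
(* With [s = t / n], the [n] steps lose at most [8 (C + 1) s^2] each, hence at most [1/2] in all, so
   the iterates stay within the radius [2] required by [HC2]. Taking [C + 1] for [C] keeps the
   bounds strict. *)
have [n n0 Hn] : exists2 n : nat, (0 < n)%N & 16 * (C + 1) * t ^+ 2 <= n%:R.
  exists (Num.bound (16 * (C + 1) * t ^+ 2)).+1 => //.
  have : 16 * (C + 1) * t ^+ 2 < (Num.bound (16 * (C + 1) * t ^+ 2))%:R.
    by apply: archi_boundP; rewrite !mulr_ge0 ?sqr_ge0 //; lra.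
  rewrite -natr1; lra.
have nR : 0 < n%:R :> R by rewrite ltr0n.
pose s := t / n%:R; have s0 : 0 < s by rewrite divr_gt0.
pose g (x : V) := x + s%:C *: H x x.
have poly k : exists2 f, vpoly f & forall l, iter k g (l *: z) =
    l *: z + l ^+ 2 *: ((k%:R * s)%:C *: H z z) + l ^+ 3 *: f l.
  elim: k => [|k [f pf IH]].
    exists (fun=> 0); first exact: vpolyC.
    by move=> l; rewrite /= mul0r scale0r !scaler0 !addr0.
  have [v vE] : exists v, v = (k%:R * s)%:C *: H z z by eexists.
  rewrite -vE in IH.
  pose f1 l := v + l *: f l.
  have pf1 : vpoly f1 by apply: vpolyD; [apply: vpolyC | apply: vpolyX].
  (* Everything of order at least three in [H] at [l z + l^2 f1(l)], divided by [l^3]. *)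
  pose f2 l := (H z (f1 l) + H (f1 l) z) + l *: H (f1 l) (f1 l).
  have pz : vpoly (fun=> z) by apply: vpolyC.
  have bil := vpoly_bilinear HDl HDr HZl HZr.
  have pf2 : vpoly f2.
    by apply: vpolyD; [apply: vpolyD; exact: bil | apply: vpolyX; exact: bil].
  have bs : vpoly (fun l => s%:C *: f2 l).
    elim: pf2 => [w|h1 h2 _ p1 _ p2|h1 _ p1]; first exact: vpolyC.
      rewrite (_ : (fun l => _) = (fun l => s%:C *: h1 l + s%:C *: h2 l)); first exact: vpolyD.
      by apply/funext => l; rewrite scalerDr.
    rewrite (_ : (fun l => _) = (fun l => l *: (s%:C *: h1 l))); first exact: vpolyX.
    by apply/funext => l; rewrite !scalerA mulrC.
  exists (fun l => f l + s%:C *: f2 l); first exact: vpolyD.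
  move=> l; rewrite iterS IH.
  have -> : l *: z + l ^+ 2 *: v + l ^+ 3 *: f l = l *: z + l ^+ 2 *: f1 l.
    by rewrite /f1 scalerDr scalerA -exprSr addrA.
  have key y : H (l *: z + l ^+ 2 *: y) (l *: z + l ^+ 2 *: y) =
      l ^+ 2 *: H z z + l ^+ 3 *: (H z y + H y z + l *: H y y).
    rewrite !(HDl, HDr, HZl, HZr) !scalerDr !scalerA.
    have -> : l * l = l ^+ 2 by ring.
    have -> : l * l ^+ 2 = l ^+ 3 by ring.
    have -> : l ^+ 2 * l = l ^+ 3 by ring.
    have -> : l ^+ 2 * l ^+ 2 = l ^+ 3 * l by ring.
    abel.
  rewrite /g key -/(f2 l).
  rewrite -natr1 mulrDl mul1r rmorphD /= [(_ + _) *: H z z]scalerDl -vE.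
  move: (f2 l) => w; rewrite /f1 !scalerDr !scalerA -exprSr !(mulrC s%:C); abel.
have bnd k l : (k <= n)%N -> cabs l = 1 ->
    N (iter k g (l *: z)) < 1 + k%:R * (8 * (C + 1) * s ^+ 2).
  move=> kn l1; elim: k kn => [|k IH] kn; first by rewrite /= NZ l1 mul1r mul0r addr0.
  have {}IH := IH (ltnW kn).
  have ss : 8 * (C + 1) * s ^+ 2 * n%:R <= 1 / 2.
    have -> : 8 * (C + 1) * s ^+ 2 * n%:R = 8 * (C + 1) * t ^+ 2 / n%:R.
      by rewrite /s; field; rewrite gt_eqF.
    rewrite ler_pdivrMr //; lra.
  rewrite iterS; set d := 8 * (C + 1) * s ^+ 2 in IH ss *.
  have s20 : 0 < s ^+ 2 by rewrite exprn_gt0.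
  have c8 : 0 <= 8 * (C + 1) by lra.
  have d0 : 0 <= d := mulr_ge0 c8 (ltW s20).
  have dE : d = 8 * C * s ^+ 2 + 8 * s ^+ 2 by rewrite /d; ring.
  have kd0 : 0 <= k%:R * d by rewrite mulr_ge0.
  have kd : k%:R * d <= n%:R * d by rewrite ler_wpM2r // ler_nat ltnW.
  have r0 : 0 < 1 + k%:R * d by lra.
  have r2 : 1 + k%:R * d <= 2 by lra.
  have := HC2 _ s _ r0 r2 IH; rewrite -/(g _) -natr1 mulrDl mul1r.
  lra.
have [f pf fE] := poly n.
have : N ((n%:R * s)%:C *: H z z) <= 2.
  apply: (@cauchy_estimate2 z _ f 2 pf) => l l1; rewrite -fE.
  apply: le_trans (ltW (bnd n l (leqnn n) l1)) _.
  have -> : n%:R * (8 * (C + 1) * s ^+ 2) = 8 * (C + 1) * t ^+ 2 / n%:R.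
    by rewrite /s; field; rewrite gt_eqF.
  have : 8 * (C + 1) * t ^+ 2 / n%:R <= 1 by rewrite ler_pdivrMr //; lra.
  lra.
have -> : n%:R * s = t by rewrite /s mulrC divfK ?gt_eqF.
by rewrite NZ cabs_real gtr0_norm.
Qed.

End vector_polynomials.

(** * Ternary morphisms *)

(** The transvection bound for [s a], with [s] real because the field is conjugate linear in [a],
    followed by [sqrt (1 + 2 t) <= 1 + t]. *)
Lemma colnm_flow (R : realType) (A : cstarAlgType R) (E : hilbertModType A)
    (z : (E * E)%type) (a : E) (s : R) : colnm z < 1 ->
  colnm (z + s%:C *: (- ract z.1 (inner a z.2), a - ract z.2 (inner a z.2)))
    <= 1 + 2 * rnorm a ^+ 2 * s ^+ 2.
Proof.
move=> z1; have := colnm_transvection (s%:C *: a) z1.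
set w := (_, _); set w' := (X in _ -> colnm X <= _).
have -> : w' = w.
  rewrite /w' /w innerZlc conjc_real !ractZr.
  rewrite [LHS]surjective_pairing /= scalerN scalerBr addrA.
  by [].
rewrite rnormZ cabs_real exprMn real_normK ?num_real //.
set r2 := rnorm a ^+ 2 => H.
have r20 : 0 <= r2 := sqr_ge0 _.
have s20 := sqr_ge0 s.
have r0 : 0 <= 2 * r2 * s ^+ 2 by rewrite mulr_ge0 // mulr_ge0.
rewrite -(@ler_pXn2r _ 2) ?nnegrE ?colnm_ge0 ?addr_ge0 //.
apply: le_trans H _; move: r0; set t := 2 * r2 * s ^+ 2 => t0.
have -> : 4 * (s ^+ 2 * r2) = 2 * t by rewrite /t; ring.
nra.
Qed.

Section ternary.
Context (R : realType) (A B : cstarAlgType R).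
Context (E : hilbertModType A) (F : hilbertModType B).
Context (T : E -> F) (S : F -> E).
Hypothesis TD : forall x y, T (x + y) = T x + T y.
Hypothesis TZ : forall (l : R[i]) x, T (l *: x) = l *: T x.
Hypothesis TK : cancel S T.
Hypothesis SK : cancel T S.
Hypothesis T_col : forall z, colnm (T z.1, T z.2) = colnm z.

Lemma ternary_morphism x a y : T (ract x (inner a y)) = ract (T x) (inner (T a) (T y)).
Proof.
have SD x' y' : S (x' + y') = S x' + S y'.
  by apply: (can_inj SK); rewrite TD !TK.
have SZ l x' : S (l *: x') = l *: S x'.
  by apply: (can_inj SK); rewrite TZ !TK.
have TN x' : T (- x') = - T x' by rewrite -scaleN1r TZ scaleN1r.
pose Tr (x' y' : F) : F := T (ract (S x') (inner a (S y'))).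
pose Tr' (x' y' : F) : F := ract x' (inner (T a) y').
pose D (x' y' : F) : F := (2^-1)%:C *: (Tr x' y' - Tr' x' y').
pose H (z w : (F * F)%type) : (F * F)%type := (D z.1 w.2, D z.2 w.2).
pose M := rnorm a ^+ 2 + rnorm (T a) ^+ 2.
have DDl x1 x2 y' : D (x1 + x2) y' = D x1 y' + D x2 y'.
  by rewrite /D /Tr /Tr' SD !ractDl TD -scalerDr; congr (_ *: _); abel.
have DDr x' y1 y2 : D x' (y1 + y2) = D x' y1 + D x' y2.
  by rewrite /D /Tr /Tr' SD !innerDr !ractDr TD -scalerDr; congr (_ *: _); abel.
have DZl l x' y' : D (l *: x') y' = l *: D x' y'.
  by rewrite /D /Tr /Tr' SZ !ractZl TZ -scalerBr !scalerA mulrC.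
have DZr l x' y' : D x' (l *: y') = l *: D x' y'.
  by rewrite /D /Tr /Tr' SZ !innerZr !ractZr TZ -scalerBr !scalerA mulrC.
have M0 : 0 <= M by rewrite addr_ge0 ?sqr_ge0.
have Hest z (s : R) : colnm z < 1 ->
    colnm (z + s%:C *: H z z) <= 1 + M * s ^+ 2.
  move=> z1; pose u : (E * E)%type := (S z.1, S z.2).
  have zE : z = (T u.1, T u.2) by rewrite /= !TK -surjective_pairing.
  have u1 : colnm u < 1 by rewrite -T_col -zE.
  (* The step [s] along the field of [T a] is averaged with the transported step [-s] along the
     field of [a]. The constant terms [s T a] and [-s T a] cancel, and convexity of the norm
     averages the two errors into [M]. *)
  have := colnm_flow (T a) s z1; set w1 := _ + _ => h1.
  have := colnm_flow a (- s) u1; rewrite -T_col sqrrN; set w2 := _ + _ => h2.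
  have -> : z + s%:C *: H z z = (2^-1)%:C *: (w1 + (T w2.1, T w2.2)).
    have half (V : lmodType R[i]) (v : V) : v = (2^-1)%:C *: (v + v).
      rewrite -mulr2n -(scaler_nat 2 v) scalerA (_ : _ * _ = 1) ?scale1r //.
      by rewrite -(rmorph_nat (real_complex R)) -rmorphM mulVf ?pnatr_eq0 // rmorph1.
    rewrite {1}[z]half [LHS]surjective_pairing [RHS]surjective_pairing.
    rewrite /w1 /w2 /H /D /= !(TD, TZ, TN) !TK -/(Tr z.1 z.2) -/(Tr z.2 z.2).
    rewrite -/(Tr' z.1 z.2) -/(Tr' z.2 z.2) !scalerA [s%:C * _]mulrC -!scalerA -!scalerDr.
    rewrite !rmorphN !scaleNr !scalerN.
    congr (_, _); congr (_ *: _); rewrite !(scalerBr, scalerDr, scalerN); abel.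
  rewrite colnmZ cabs_real ger0_norm ?invr_ge0 //.
  have := colnmD w1 (T w2.1, T w2.2); rewrite /M; lra.
have HDl (z1 z2 w : (F * F)%type) : H (z1 + z2) w = H z1 w + H z2 w.
  by rewrite /H /= !DDl.
have HDr (w z1 z2 : (F * F)%type) : H w (z1 + z2) = H w z1 + H w z2.
  by rewrite /H /= !DDr.
have HZl l (z w : (F * F)%type) : H (l *: z) w = l *: H z w.
  by rewrite /H /= !DZl.
have HZr l (z w : (F * F)%type) : H z (l *: w) = l *: H z w.
  by rewrite /H /= !DZr.
have H0 := @cartan_quadratic R (F * F)%type (@colnm R B F) (@colnmD R B F) (@colnmZ R B F)
  H M HDl HDr HZl HZr (@colnm_ge0 R B F) M0 Hest (T x, T y).
(* The first row of [H] at the column [(T x, T y)] is [D (T x) (T y)], where [x] and [y] are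
   independent. *)
have /(congr1 fst) /= := colnm_eq0 H0.
rewrite /D /Tr /Tr' !SK => /eqP; rewrite scaler_eq0 subr_eq0 => /orP[|/eqP //].
by rewrite -(rmorph0 (real_complex R)) (inj_eq (@complexI _)) invr_eq0 pnatr_eq0.
Qed.

End ternary.

(** * The isomorphism of the inner product ideals *)

Lemma closureP_rnorm (R : realType) (V : normedModType R[i]) (S : set V) a :
  closure S a <-> forall e : R, 0 < e -> exists2 b, S b & rnorm (a - b) <= e.
Proof.
split=> [Sa e e0|H X].
  have e0' : 0 < e%:C by rewrite ltcR.
  have [b [Sb ab]] := Sa _ (nbhsx_ballx a _ e0').
  exists b => //; move: ab; rewrite -ball_normE /= rnormE ltcR; exact: ltW.
move=> /nbhs_ballP[e /= e0 eX].
have eE : e = (complex.Re e)%:C by rewrite RRe_real // gtr0_real.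
have e0' : 0 < complex.Re e by rewrite -ltcR -eE.
have [b Sb ab] := H (complex.Re e / 2) (divr_gt0 e0' (ltr0Sn _ 1)).
exists b; split=> //; apply: eX; rewrite -ball_normE /= rnormE eE ltcR; lra.
Qed.

Lemma closure_lipschitz (R : realType) (V W : normedModType R[i]) (S : set V)
    (S' : set W) (f : V -> W) (C : R) a :
  0 <= C -> (forall x y, rnorm (f x - f y) <= C * rnorm (x - y)) ->
  (forall x, S x -> S' (f x)) -> closure S a -> closure S' (f a).
Proof.
move=> C0 fC fS /closureP_rnorm Sa; apply/closureP_rnorm => e e0.
have C1 : 0 < C + 1 by lra.
have [b Sb ab] := Sa (e / (C + 1)) (divr_gt0 e0 C1).
exists (f b); first exact: fS.
apply: le_trans (fC _ _) _; apply: le_trans (ler_wpM2l C0 ab) _.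
by rewrite mulrA ler_pdivrMr // mulrC ler_pM2l //; lra.
Qed.

Section inner_ideal.
Context (R : realType) (A : cstarAlgType R) (E : hilbertModType A).
Implicit Types (x y z : E) (a b : A).

Lemma inner_span_inner x y : inner_span E (inner x y).
Proof.
exists 1%N, (fun=> 1), (fun=> x), (fun=> y).
by rewrite big_ord_recl big_ord0 addr0 scale1r.
Qed.

Lemma inner_ideal_inner x y : inner_ideal E (inner x y).
Proof. exact/subset_closure/inner_span_inner. Qed.

Lemma inner_spanD a b : inner_span E a -> inner_span E b -> inner_span E (a + b).
Proof.
move=> [n [l [x [y ->]]]] [m [l' [x' [y' ->]]]].
pose pick X (f : 'I_n -> X) (g : 'I_m -> X) (i : 'I_(n + m)) :=
  match fintype.split i with inl j => f j | inr j => g j end.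
exists (n + m)%N, (pick _ l l'), (pick _ x x'), (pick _ y y').
rewrite big_split_ord /=; congr (_ + _); apply: eq_bigr => i _; rewrite /pick.
  by rewrite -[lshift m i]/(unsplit (inl i)) unsplitK.
by rewrite -[rshift n i]/(unsplit (inr i)) unsplitK.
Qed.

Lemma inner_spanZ (c : R[i]) a : inner_span E a -> inner_span E (c *: a).
Proof.
move=> [n [l [x [y ->]]]]; exists n, (fun i => c * l i), x, y.
by rewrite scaler_sumr; apply: eq_bigr => i _; rewrite scalerA.
Qed.

Lemma cstar_sum n (f : 'I_n -> A) : cstar (\sum_i f i) = \sum_i cstar (f i).
Proof. by apply: (big_morph _ (@cstarD _ _)); apply: cstar0. Qed.

Lemma cmul_suml n (f : 'I_n -> A) b : cmul (\sum_i f i) b = \sum_i cmul (f i) b.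
Proof. by apply: (big_morph (fun a => cmul a b)) => [x y|]; rewrite ?cmulDl ?cmul0l. Qed.

Lemma inner_span_star a : inner_span E a -> inner_span E (cstar a).
Proof.
move=> [n [l [x [y ->]]]]; exists n, (fun i => conjc (l i)), y, x.
by rewrite cstar_sum; apply: eq_bigr => i _; rewrite cstarZc inner_star.
Qed.

Lemma inner_spanM a b : inner_span E a -> inner_span E (cmul a b).
Proof.
move=> [n [l [x [y ->]]]]; exists n, l, x, (fun i => ract (y i) b).
by rewrite cmul_suml; apply: eq_bigr => i _; rewrite cmulZl innerMr.
Qed.

Lemma inner_idealD a b : inner_ideal E a -> inner_ideal E b -> inner_ideal E (a + b).
Proof.
move=> /closureP_rnorm Ia /closureP_rnorm Ib; apply/closureP_rnorm => e e0.
have e2 : 0 < e / 2 by lra.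
have [a' Sa' ha] := Ia _ e2; have [b' Sb' hb] := Ib _ e2.
exists (a' + b'); first exact: inner_spanD.
have -> : a + b - (a' + b') = (a - a') + (b - b') by abel.
by apply: le_trans (rnormD _ _) _; lra.
Qed.

Lemma inner_idealZ (c : R[i]) a : inner_ideal E a -> inner_ideal E (c *: a).
Proof.
apply: (@closure_lipschitz _ _ _ _ _ (fun a => c *: a) (cabs c)); first exact: cabs_ge0.
  by move=> x y; rewrite -scalerBr rnormZ.
exact: inner_spanZ.
Qed.

Lemma inner_idealB a b : inner_ideal E a -> inner_ideal E b -> inner_ideal E (a - b).
Proof.
by move=> Ia Ib; rewrite -scaleN1r; apply: inner_idealD => //; apply: inner_idealZ.
Qed.

Lemma inner_ideal_star a : inner_ideal E a -> inner_ideal E (cstar a).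
Proof.
apply: (@closure_lipschitz _ _ _ _ _ (fun a => cstar a) 1) => //.
  by move=> x y; rewrite -cstarN -cstarD rnorm_cstar mul1r.
exact: inner_span_star.
Qed.

Lemma inner_idealM a b : inner_ideal E a -> inner_ideal E (cmul a b).
Proof.
apply: (@closure_lipschitz _ _ _ _ _ (fun a => cmul a b) (rnorm b)).
- exact: rnorm_ge0.
- by move=> x y; rewrite -cmulNl -cmulDl mulrC; apply: rnormM.
- by move=> x; apply: inner_spanM.
Qed.

(** Approximate [a^*] by sums of [l <x, y>]: each [<x, y> a = <x, y a>] vanishes, so [a^* a = 0]. *)
Lemma inner_ideal_faithful a :
  inner_ideal E a -> (forall z, ract z a = 0) -> a = 0.
Proof.
move=> /inner_ideal_star/closureP_rnorm Ia za.
have : cmul (cstar a) a = 0.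
  apply: (@rnorm_small_eq0 _ _ _ (rnorm a)); first exact: rnorm_ge0.
  move=> e /Ia[b [n [l [x [y ->]]]]] hb.
  have -> : cmul (cstar a) a =
      cmul (cstar a - \sum_i l i *: inner (x i) (y i)) a.
    rewrite cmulDl cmulNl cmul_suml big1 ?subr0 // => i _.
    by rewrite cmulZl -innerMr za inner0r scaler0.
  apply: le_trans (rnormM _ _) _.
  by rewrite mulrC ler_wpM2l ?rnorm_ge0.
move=> aa; apply: rnorm_eq0; apply/eqP; rewrite -sqrf_eq0 -rnorm_cstarM aa.
by rewrite rnorm0.
Qed.

Lemma ract0 x : ract x 0 = 0.
Proof. by rewrite -(scale0r 0) ractZr !scale0r. Qed.

Lemma ractNr x a : ract x (- a) = - ract x a.
Proof. by rewrite -scaleN1r ractZr scaleN1r. Qed.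

Lemma ract_sumr n (f : 'I_n -> A) x : ract x (\sum_i f i) = \sum_i ract x (f i).
Proof. by apply: (big_morph (ract x)) => [a b|]; rewrite ?ractDr ?ract0. Qed.

End inner_ideal.

(** * Transfer of the inner product ideal along an isometric ternary morphism *)

Section transfer.
Context (R : realType) (A B : cstarAlgType R).
Context (E : hilbertModType A) (F : hilbertModType B).
Context (T : E -> F).
Hypothesis TD : forall x y, T (x + y) = T x + T y.
Hypothesis TZ : forall (l : R[i]) x, T (l *: x) = l *: T x.
Hypothesis T_iso : forall x, rnorm (T x) = rnorm x.
Hypothesis T_ternary :
  forall x a y, T (ract x (inner a y)) = ract (T x) (inner (T a) (T y)).

Definition intertwined (a : A) (b : B) := forall z, T (ract z a) = ract (T z) b.

(** A relation, since independence of the representation is not yet known; the contraction estimate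
    applied to differences provides it. *)
Definition span_pair (a : A) (b : B) :=
  exists (n : nat) (l : 'I_n -> R[i]) (x y : 'I_n -> E),
    a = \sum_(i < n) l i *: inner (x i) (y i) /\
    b = \sum_(i < n) l i *: inner (T (x i)) (T (y i)).

Lemma isometry_sum n (f : 'I_n -> E) : T (\sum_i f i) = \sum_i T (f i).
Proof.
apply: (big_morph T) => //; by rewrite -(scale0r 0) TZ !scale0r.
Qed.

Lemma span_pair_intertwined a b : span_pair a b -> intertwined a b.
Proof.
move=> [n [l [x [y [-> ->]]]]] z; rewrite !ract_sumr isometry_sum.
by apply: eq_bigr => i _; rewrite !ractZr TZ T_ternary.
Qed.

Lemma span_pair_star a b : span_pair a b -> span_pair (cstar a) (cstar b).
Proof.
move=> [n [l [x [y [-> ->]]]]]; exists n, (fun i => conjc (l i)), y, x.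
by rewrite !cstar_sum; split; apply: eq_bigr => i _; rewrite cstarZc inner_star.
Qed.

Lemma span_pairB a b a' b' :
  span_pair a b -> span_pair a' b' -> span_pair (a - a') (b - b').
Proof.
move=> [n [l [x [y [-> ->]]]]] [m [l' [x' [y' [-> ->]]]]].
pose pick X (f : 'I_n -> X) (g : 'I_m -> X) (i : 'I_(n + m)) :=
  match fintype.split i with inl j => f j | inr j => g j end.
exists (n + m)%N, (pick _ l (fun i => - l' i)), (pick _ x x'), (pick _ y y').
rewrite !big_split_ord /= -!sumrN.
split; congr (_ + _); apply: eq_bigr => i _; rewrite /pick.
- by rewrite -[lshift m i]/(unsplit (inl i)) unsplitK.
- by rewrite -[rshift n i]/(unsplit (inr i)) unsplitK scaleNr.
- by rewrite -[lshift m i]/(unsplit (inl i)) unsplitK.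
- by rewrite -[rshift n i]/(unsplit (inr i)) unsplitK scaleNr.
Qed.

(** [<T y, T x> d' = <T y, T (x d)>] depends on [d'] only through [d]. The crude [K] depends on the
    representation; taking powers removes it. *)
Lemma span_pair_bound a b : span_pair a b -> exists2 K, 0 <= K &
  forall d d', intertwined d d' -> rnorm (cmul (cstar b) d') <= K * rnorm d.
Proof.
move=> [n [l [x [y [_ ->]]]]].
exists (\sum_(i < n) cabs (l i) * (rnorm (T (y i)) * rnorm (x i))).
  by apply: sumr_ge0 => i _; rewrite !mulr_ge0 ?cabs_ge0 ?rnorm_ge0.
move=> d d' dd'; rewrite cstar_sum cmul_suml mulr_suml.
elim/big_ind2: _ => [|u p v q up vq|i _]; first by rewrite rnorm0.
  by apply: le_trans (rnormD _ _) _; apply: lerD.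
rewrite cstarZc inner_star cmulZl -innerMr -dd' rnormZ cabs_conj -!mulrA.
apply: ler_wpM2l; first exact: cabs_ge0.
apply: le_trans (inner_cauchy_schwarz _ _) _; rewrite !T_iso.
by rewrite ler_wpM2l ?rnorm_ge0 ?rnorm_ract.
Qed.

(* [|b|^(2n) = |(b^*b)^n| <= K |a(a^*a)^(n-1)| <= K |a|^(2n-1)] for all [n]. *)
Lemma span_pair_contract a b : span_pair a b -> rnorm b <= rnorm a.
Proof.
move=> ab; have [K K0 HK] := span_pair_bound ab.
have iab := span_pair_intertwined ab.
have iab' := span_pair_intertwined (span_pair_star ab).
pose q k := iter k (fun c => cmul c (cmul (cstar a) a)) a.
pose q' k := iter k (fun c => cmul c (cmul (cstar b) b)) b.
have iq k : intertwined (q k) (q' k).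
  elim: k => [|k IH] z //=.
  by rewrite !ractM iab iab' -/(q k) IH.
have nq k : rnorm (q k) <= rnorm a ^+ (2 * k).+1.
  elim: k => [|k IH]; first by rewrite muln0 expr1.
  have -> : (2 * k.+1).+1 = ((2 * k).+1 + 2)%N by rewrite mulnS add2n addn2.
  have -> : q k.+1 = cmul (q k) (cmul (cstar a) a) by [].
  apply: le_trans (rnormM _ _) _; rewrite rnorm_cstarM exprD.
  by rewrite ler_wpM2r ?sqr_ge0.
have nq' k : rnorm (cmul (cstar b) (q' k)) = (rnorm b ^+ 2) ^+ k.+1.
  pose h := cmul (cstar b) b; pose W := unitization_cstar B.
  have hE : un_inj (cmul (cstar b) (q' k)) = un_inj h ^+ k.+1.
    elim: k => [|k IH] //=.
    by rewrite -/(q' k) cmulA un_injM IH [RHS]exprSr.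
  rewrite -un_norm_inj hE [LHS](unmX (W := W)).
    by rewrite [unm _ _]un_norm_inj rnorm_cstarM.
  by rewrite -[LHS]un_inj_star /h cstarM cstarK.
rewrite -(@ler_pXn2r _ 2) ?nnegrE ?rnorm_ge0 //.
(* The division absorbs the odd exponent [2m + 1]. If [|a| = 0] the quotient is [0] by convention,
   which is harmless since [|a|^(2m+1)] vanishes too. *)
apply: (@le_of_pow2_growth _ _ _ (K / rnorm a) 0); rewrite ?sqr_ge0 //.
move=> j; rewrite mulr0 addr0.
have [m mE] : exists m, (2 ^ j = m.+1)%N.
  by exists (2 ^ j).-1; rewrite prednK // expn_gt0.
rewrite mE -nq'; apply: le_trans (HK _ _ (iq m)) _.
apply: le_trans (ler_wpM2l K0 (nq m)) _.
rewrite -exprM mulnS add2n -[leRHS]mulrA [X in _ <= K * (_ * X)]exprS ler_wpM2l //.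
have [->|a0] := eqVneq (rnorm a) 0; first by rewrite exprS mul0r !mulr0.
by rewrite mulKf.
Qed.

(** Approximants of [a] in the span have partners that form a Cauchy sequence, by the contraction
    estimate on differences; intertwining passes to the limit. *)
Lemma transfer_exists a : inner_ideal E a ->
  exists b, inner_ideal F b /\ intertwined a b.
Proof.
move=> /closureP_rnorm Ia.
have /boolp.choice[p Hp] : forall n, exists p : A * B,
    span_pair p.1 p.2 /\ rnorm (a - p.1) <= 2^-1 ^+ n.
  move=> n; have [|c [m [l [x [y ->]]]] hc] := Ia (2^-1 ^+ n).
    by rewrite exprn_gt0 // invr_gt0.
  exists (\sum_i l i *: inner (x i) (y i), \sum_i l i *: inner (T (x i)) (T (y i))).
  by split=> //; exists m, l, x, y.
have half01 : 0 <= (2^-1 : R) < 1 by lra.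
(* At ratio [1/2] this gives [2^-n <= e / 2], so any two later approximants differ by at most
   [e]. *)
have small := geometric_eventually ler01 half01.
have mono n k : (n <= k)%N -> 2^-1 ^+ k <= 2^-1 ^+ n :> R.
  by move=> nk; apply: ler_wiXn2l => //; lra.
have [|b Hb] := @rnorm_complete _ B (fun n => (p n).2).
  move=> e /small[n Hn]; exists n => k nk.
  have [pk ak] := Hp k; have [pn an] := Hp n.
  apply: le_trans (span_pair_contract (span_pairB pk pn)) _.
  have := rnorm_dist (p k).1 a (p n).1; rewrite (rnorm_distC (p k).1 a).
  have := mono _ _ nk; lra.
exists b; split.
  apply/closureP_rnorm => e /Hb[n Hn]; exists (p n).2.
    by have [[m [l [x [y [_ ->]]]]] _] := Hp n; exists m, l, (T \o x), (T \o y).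
  by rewrite rnorm_distC; apply: Hn.
move=> z; apply/eqP; rewrite -subr_eq0; apply/eqP.
apply: (@rnorm_small_eq0 _ _ _ (rnorm z + rnorm z)); first by rewrite addr_ge0 ?rnorm_ge0.
move=> e e0; have [n Hn] := small _ e0; have [m Hm] := Hb _ e0.
pose k := maxn n m.
have [pk ak] := Hp k; have ik := span_pair_intertwined pk.
have -> : T (ract z a) - ract (T z) b =
    T (ract z (a - (p k).1)) + ract (T z) ((p k).2 - b).
  have TN x : T (- x) = - T x by rewrite -scaleN1r TZ scaleN1r.
  by rewrite !ractDr !ractNr TD TN ik; abel.
apply: le_trans (rnormD _ _) _; rewrite T_iso mulrDl; apply: lerD.
  apply: le_trans (rnorm_ract _ _) _; rewrite ler_wpM2l ?rnorm_ge0 //.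
  apply: le_trans ak _; apply: le_trans (mono _ _ (leq_maxl n m)) _; lra.
apply: le_trans (rnorm_ract _ _) _; rewrite T_iso ler_wpM2l ?rnorm_ge0 //.
by apply: Hm; apply: leq_maxr.
Qed.

End transfer.

Theorem theorem9 (R : realType) (A B : cstarAlgType R)
    (E : hilbertModType A) (F : hilbertModType B) (T : {linear E -> F})
    (T_surj : set_surj [set: E] [set: F] T) (T_2iso : n_isometry 2 T) :
  exists phi : A -> B,
    [/\ star_isomorphism_on (inner_ideal E) (inner_ideal F) phi,
        forall x y : E, inner (T x) (T y) = phi (inner x y)
      & forall (x : E) (a : A), inner_ideal E a ->
          T (ract x a) = ract (T x) (phi a)].
Proof.
have T_col := colnm_2isometry T_2iso.
have T_iso x : rnorm (T x) = rnorm x.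
  have := T_col (x, 0); rewrite /colnm /colip /= linear0 !inner0r !addr0 !rnorm_inner.
  by rewrite !sqrtr_sqr !ger0_norm ?rnorm_ge0.
have T_inj : injective T.
  move=> x y xy; apply/eqP; rewrite -subr_eq0; apply/eqP/rnorm_eq0.
  by rewrite -T_iso linearB xy subrr rnorm0.
have /boolp.choice[S TK] : forall y, exists x, T x = y.
  by move=> y; have [x _ <-] := T_surj y I; exists x.
have SK : cancel T S by move=> x; apply: T_inj; rewrite TK.
have TD x y : T (x + y) = T x + T y by rewrite linearD.
have TZ l x : T (l *: x) = l *: T x by rewrite linearZ.
have SD x y : S (x + y) = S x + S y by apply: T_inj; rewrite TD !TK.
have SZ l x : S (l *: x) = l *: S x by apply: T_inj; rewrite TZ !TK.
have S_iso x : rnorm (S x) = rnorm x by rewrite -T_iso TK.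
have T_tern := ternary_morphism TD TZ TK SK T_col.
have S_tern x a y : S (ract x (inner a y)) = ract (S x) (inner (S a) (S y)).
  by apply: T_inj; rewrite T_tern !TK.
have /boolp.choice[phi Hphi] : forall a, exists b, inner_ideal E a ->
    inner_ideal F b /\ intertwined T a b.
  move=> a; have [Ia|nIa] := pselect (inner_ideal E a); last by exists 0.
  by have [b Hb] := transfer_exists TD TZ T_iso T_tern Ia; exists b.
(* By surjectivity of [T] and faithfulness of the action, an element of the ideal is determined by
   what it intertwines; additivity, homogeneity and multiplicativity of [phi] follow. *)
have uniq a b b' : inner_ideal F b -> inner_ideal F b' ->
    intertwined T a b -> intertwined T a b' -> b = b'.
  move=> Jb Jb' ab ab'; apply/eqP; rewrite -subr_eq0; apply/eqP.
  apply: (inner_ideal_faithful (inner_idealB Jb Jb')) => w.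
  by rewrite -[w]TK ractDr ractNr -ab -ab' subrr.
have phi_eq a b : inner_ideal E a -> inner_ideal F b -> intertwined T a b -> phi a = b.
  by move=> /Hphi[Jp pa] Jb ab; apply: uniq ab.
have phi_inner x y : phi (inner x y) = inner (T x) (T y).
  by apply: phi_eq => [||z]; [exact: inner_ideal_inner..| exact: T_tern].
have phiM a b : inner_ideal E a -> inner_ideal E b ->
    phi (cmul a b) = cmul (phi a) (phi b).
  move=> Ia Ib; have [Ja ia] := Hphi _ Ia; have [Jb ib] := Hphi _ Ib.
  apply: phi_eq; [exact: inner_idealM|exact: inner_idealM|] => z.
  by rewrite !ractM ib ia.
exists phi; split; last 2 first.
- by move=> x y; rewrite phi_inner.
- by move=> x a /Hphi[_]; apply.
split.
- split.
  + by move=> a /Hphi[].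
  + move=> a b; rewrite !inE => Ia Ib ab.
    apply/eqP; rewrite -subr_eq0; apply/eqP.
    apply: (inner_ideal_faithful (inner_idealB Ia Ib)) => z; apply: T_inj.
    have [_ ia] := Hphi _ Ia; have [_ ib] := Hphi _ Ib.
    by rewrite ractDr ractNr linearB ia ib ab subrr linear0.
  (* The inverse [S] is again an isometric ternary morphism, and the partner of [b] along it is the
     preimage. *)
  + move=> b Jb.
    have [a [Ia ba]] := transfer_exists SD SZ S_iso S_tern Jb.
    exists a => //; apply: phi_eq => // z.
    by rewrite -[z]SK -ba TK SK.
- move=> a b Ia Ib; have [Ja ia] := Hphi _ Ia; have [Jb ib] := Hphi _ Ib.
  apply: phi_eq; [exact: inner_idealD|exact: inner_idealD|] => z.
  by rewrite !ractDr linearD ia ib.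
- move=> l a Ia; have [Ja ia] := Hphi _ Ia.
  apply: phi_eq; [exact: inner_idealZ|exact: inner_idealZ|] => z.
  by rewrite !ractZr linearZ ia.
- exact: phiM.
- move=> a Ia; have [Ja ia] := Hphi _ Ia.
  apply: phi_eq; [exact: inner_ideal_star|exact: inner_ideal_star|] => z.
  apply/eqP; rewrite -subr_eq0; apply/eqP/inner_eq0.
  (* Right actions do not reveal adjoints, so the two vectors are paired with [T w]: both pairings
     equal [phi(a) phi(<z, w>)], and [T] is onto. *)
  suff nondeg w : inner (T (ract z (cstar a)) - ract (T z) (cstar (phi a))) (T w) = 0.
    by set v := _ - _ in nondeg *; rewrite -[X in inner v X]TK.
  rewrite innerDl innerNl innerMl cstarK -!phi_inner innerMl cstarK.
  by rewrite phiM ?subrr //; apply: inner_ideal_inner.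
Qed.
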